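(* Let $F$ be a double-well potential satisfying the standing assumptions listed in the context, with $F(x_0)<F(x_1)$. For each $\varepsilon>0$ let $(\xi_0,\xi_1)=(\xi_{0,\varepsilon},\xi_{1,\varepsilon})$ be an admissible pair and let $(X,Y)=(X_\varepsilon,Y_\varepsilon)$ be the corresponding coupled process. Then the following three conditions are equivalent: (1) $P(X_\varepsilon(t)<0\mid Y_\varepsilon(t)=0)\to 1$ as $\varepsilon\to0$, for each $t\ge 0$. (a) $\xi_0=o(|\eta(-\infty)|^{-1})$ as $\varepsilon\to0$. (b) $E[g(X(t))\mid Y(t)=0]-E^{\varpi}[g(X(0))\mid X(0)<0]\to0$ as $\varepsilon\to0$, for each $t\ge0$ and each bounded, measurable $g:\mathbb{R}\to\mathbb{R}$ that is continuous at $x_0$ and $x_1$.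
   Context: Standing assumptions on $F$: $F\in C^3(\mathbb{R})$, $F(x)\to\infty$ as $|x|\to\infty$; there are constants $a_1,a_2,c_1,c_2,c_3,c_4>0$ with $a_2<2a_1-2$ such that for all $x$, $c_1|x|^{a_1}-c_2\le |F'(x)|^2\le c_3|x|^{a_2}+c_4$ and $c_1|x|^{a_1}-c_2\le(|F'(x)|-2F''(x))^2\le c_3|x|^{a_2}+c_4$. There are points $x_0<0<x_1$ such that $F$ is strictly decreasing on $(-\infty,x_0)$ and $(0,x_1)$, strictly increasing on $(x_0,0)$ and $(x_1,\infty)$, $F''(x_0)>0$, $F''(0)<0$, $F''(x_1)>0$, and $F(x_0)<F(x_1)$. Eigenfunction: for each $\varepsilon>0$ put $\mu(dx)=e^{-F(x)/\varepsilon}dx$, $\varpi=\mu(\mathbb{R})^{-1}\mu$, and $Af=\varepsilon f''-F'f'$. Let $-\lambda=-\lambda_\varepsilon<0$ be the second eigenvalue of $A$ in $L^2(\varpi)$ (the first is $0$, with constant eigenfunctions) and $\eta=\eta_\varepsilon$ a corresponding eigenfunction, so $\varepsilon\eta''-F'\eta'=-\lambda\eta$. It is known that $\eta$ is continuous and bounded and, with the sign of $\eta$ suitably fixed, there is $r_\varepsilon\in\mathbb{R}$ with $\eta<0$ on $(-\infty,r_\varepsilon)$, $\eta(r_\varepsilon)=0$, $\eta>0$ on $(r_\varepsilon,\infty)$, and $\eta$ is strictly increasing. Write $\eta(\pm\infty)=\lim_{x\to\pm\infty}\eta(x)$ (finite). Coupling: a pair $(\xi_0,\xi_1)\in\mathbb{R}^2$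 (depending on $\varepsilon$) is admissible if $-1/\eta(\infty)\le\xi_j\le1/|\eta(-\infty)|$ for $j=0,1$ and $\xi_0\xi_1<0$. Given an admissible pair set $a_j=\lambda\xi_j/(\xi_j-\xi_{1-j})>0$, $Q=\begin{pmatrix} -a_0 & a_0 \\ a_1 & -a_1 \end{pmatrix}$ (rows and columns indexed by $0,1$), and $\alpha_j=1+\xi_j\eta>0$. Choose any probability vector $p=(p_0,p_1)$, and let $(X_\varepsilon,Y_\varepsilon)$ be the cadlag Markov process on $\mathbb{R}\times\{0,1\}$ with initial distribution $\nu(\Gamma\times\{i\})=p_i\int_\Gamma\alpha_i\,d\varpi$ and generator $Bf(x,i)=Af(\cdot,i)(x)+\sum_{j\ne i}Q_{ij}\frac{\alpha_j(x)}{\alpha_i(x)}(f(x,j)-f(x,i))$. It is known that $X_\varepsilon$ solves $X_\varepsilon(t)=X_\varepsilon(0)-\int_0^tF'(X_\varepsilon(s))ds+\sqrt{2\varepsilon}\,W(t)$ with $W$ a standard Brownian motion, that $Y_\varepsilon$ is a continuous-time Markov chain with generator $Q$, and that $P(X_\varepsilon(t)\in\Gamma\mid Y_\varepsilon(t)=j)=\int_\Gamma\alpha_j\,d\varpi=\varpi(\Gamma)+\xi_j\int_\Gamma\eta\,d\varpi$ for all $t\ge0$, $j\in\{0,1\}$ and Borel $\Gamma\subset\mathbb{R}$ (this formula is taken as the meaning of the conditional law if $P(Y_\varepsilon(t)=j)=0$). $E^\varpi$ denotes expectation when $X(0)$ has law $\varpi$. Dependence on $\varepsilon$ is suppressed in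 the notation. *)

(* Defs.v *)
From HB Require Import structures.
From mathcomp Require Import all_boot all_order all_algebra.
From mathcomp Require Import all_classical all_reals all_analysis.
From mathcomp Require Import measurable_realfun.

Set Implicit Arguments.
Unset Strict Implicit.
Unset Printing Implicit Defensive.

Import Order.TTheory GRing.Theory Num.Theory.
Import numFieldNormedType.Exports.

Local Open Scope classical_set_scope.
Local Open Scope ring_scope.

(* Everything below is written with MathComp-Analysis, over [R : realType]. *)

Record double_well (R : realType) (F : R -> R) (x0 x1 : R) : Prop := {
  dw_derivable : forall k x, (k < 3)%N -> derivable (derive1n k F) x 1 ;
  dw_continuous3 : continuous (derive1n 3 F) ;
  dw_cvgNy : F x @[x --> -oo] --> +oo ;
  dw_cvgy : F x @[x --> +oo] --> +oo ;
  dw_growth : exists a1 a2 c1 c2 c3 c4 : R,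
    [/\ [/\ 0 < a1, 0 < a2, 0 < c1, 0 < c2 & 0 < c3 /\ 0 < c4],
        a2 < 2 * a1 - 2,
        (forall x, c1 * `|x| `^ a1 - c2 <= `|derive1 F x| ^+ 2
                     <= c3 * `|x| `^ a2 + c4)
      & (forall x, c1 * `|x| `^ a1 - c2
                     <= (`|derive1 F x| - 2 * derive1n 2 F x) ^+ 2
                     <= c3 * `|x| `^ a2 + c4)] ;
  dw_order : x0 < 0 < x1 ;
  dw_decr_left : {in `]-oo, x0[ &, {homo F : x y /~ x < y}} ;
  dw_incr_left : {in `]x0, 0[ &, {homo F : x y / x < y}} ;
  dw_decr_right : {in `]0, x1[ &, {homo F : x y /~ x < y}} ;
  dw_incr_right : {in `]x1, +oo[ &, {homo F : x y / x < y}} ;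
  dw_convex0 : 0 < derive1n 2 F x0 ;
  dw_concave : derive1n 2 F 0 < 0 ;
  dw_convex1 : 0 < derive1n 2 F x1
}.

Section gibbs.
Context (R : realType).
Local Open Scope ereal_scope.

(* [F] is bundled with its measurability so that [gibbs] is a measure without
   side conditions; a C^3 function is measurable, so nothing is lost. *)
Definition gibbs (F : {mfun R >-> R}) (eps : R) (A : set R) : \bar R :=
  \int[lebesgue_measure]_(x in A) (expR (- F x / eps))%:E.

Variables (F : {mfun R >-> R}) (eps : R).

Let gibbs0 : gibbs F eps set0 = 0.
Proof. by rewrite /gibbs integral_set0. Qed.

Let gibbs_ge0 A : 0 <= gibbs F eps A.
Proof. by apply: integral_ge0 => x _; rewrite lee_fin expR_ge0. Qed.

Let gibbs_sigma_additive : semi_sigma_additive (gibbs F eps).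
Proof.
move=> A mA tA mUA; rewrite /gibbs; apply: cvg_toP.
  apply: ereal_nondecreasing_is_cvgn => m n mn.
  by apply: lee_sum_nneg_natr => // k _ _; exact: gibbs_ge0.
rewrite ge0_integral_bigcup//=.
apply/measurable_EFinP/measurable_funTS.
apply: (measurableT_comp (@measurable_expR R)) => //=.
apply: measurable_funM => //.
have mF : measurable_fun setT F by exact: measurable_funPT.
by apply: (@measurableT_comp _ _ _ _ _ _ (@GRing.opp R)) mF; exact: oppr_measurable.
Qed.

HB.instance Definition _ := isMeasure.Build _ _ _
  (gibbs F eps) gibbs0 gibbs_ge0 gibbs_sigma_additive.

End gibbs.

(* [mnormalize] falls back on its second argument when the total mass is 0 or
   +oo, which does not happen for a double well and [0 < eps]. *)
Definition varpi (R : realType) (F : {mfun R >-> R}) (eps : R) :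
    probability R R :=
  mnormalize (gibbs F eps) \d_(0 : R).

Section spectrum.
Context (R : realType) (F : {mfun R >-> R}) (eps : R).

Definition genA (f : R -> R) (x : R) : R :=
  eps * derive1n 2 f x - derive1 F x * derive1 f x.

(* The maximal domain of [A] in L^2. By elliptic regularity an eigenfunction in
   the sense of distributions is a classical solution of the equation. *)
Definition domA (f : R -> R) : Prop :=
  [/\ forall x, derivable f x 1, forall x, derivable (derive1 f) x 1,
      f \in Lfun (varpi F eps) 2%:E & genA f \in Lfun (varpi F eps) 2%:E].

Definition eigenfunctionA (v : R) (f : R -> R) : Prop :=
  [/\ domA f, exists x, f x != 0 & forall x, genA f x = v * f x].

Definition eigenvalueA (v : R) : Prop := exists f, eigenfunctionA v f.

Definition second_eigenvalueA (v : R) : Prop :=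
  [/\ v < 0, eigenvalueA v & forall v', eigenvalueA v' -> v < v' -> v' = 0].

End spectrum.

(* Boundedness, the single sign change and monotonicity are properties of every
   second eigenfunction, up to the choice of its sign. *)
Record second_eigenpair (R : realType) (F : {mfun R >-> R}) (eps lam : R)
    (eta : R -> R) : Prop := {
  se_eigenvalue : second_eigenvalueA F eps (- lam) ;
  se_eigenfunction : eigenfunctionA F eps (- lam) eta ;
  se_bounded : exists M, forall x, `|eta x| <= M ;
  se_sign : exists r, [/\ forall x, x < r -> eta x < 0, eta r = 0
                        & forall x, r < x -> 0 < eta x] ;
  se_increasing : {homo eta : x y / x < y}
}.

Definition lim_ninfty (R : realType) (eta : R -> R) : R :=
  lim (eta x @[x --> -oo]).

Definition lim_pinfty (R : realType) (eta : R -> R) : R :=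
  lim (eta x @[x --> +oo]).

Definition admissible (R : realType) (eta : R -> R) (xi : 'I_2 -> R) : Prop :=
  (forall j, - (lim_pinfty eta)^-1 <= xi j <= `|lim_ninfty eta|^-1) /\
  xi 0 * xi 1 < 0.

Section coupling.
Context (R : realType).

Definition is_probability_vector (p : 'I_2 -> R) : Prop :=
  (forall i, 0 <= p i) /\ \sum_i p i = 1.

Definition alpha (eta : R -> R) (xi : 'I_2 -> R) (j : 'I_2) (x : R) : R :=
  1 + xi j * eta x.

(* [1 - j] is computed in the ring ['I_2] of integers modulo 2. *)
Definition rate (lam : R) (xi : 'I_2 -> R) (j : 'I_2) : R :=
  lam * xi j / (xi j - xi (1 - j)).

Definition Qmx (lam : R) (xi : 'I_2 -> R) : 'M[R]_2 :=
  \matrix_(i, j) (if i == j then - rate lam xi i else rate lam xi i).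

Definition genB (F : {mfun R >-> R}) (eps lam : R) (eta : R -> R)
    (xi : 'I_2 -> R) (f : R -> 'I_2 -> R) (x : R) (i : 'I_2) : R :=
  genA F eps (f^~ i) x
  + \sum_(j | j != i)
      Qmx lam xi i j * (alpha eta xi j x / alpha eta xi i x)
      * (f x j - f x i).

(* Functions on R * {0,1} that are C^2 with compact support in the first
   variable. *)
Definition test_function (f : R -> 'I_2 -> R) : Prop :=
  forall i, [/\ forall x, derivable (f^~ i) x 1,
                forall x, derivable (derive1 (f^~ i)) x 1,
                continuous (derive1n 2 (f^~ i))
              & exists K, forall x, K < `|x| -> f x i = 0].

Definition bounded_measurable (g : R -> 'I_2 -> R) : Prop :=
  forall i, measurable_fun setT (g^~ i) /\ exists M, forall x, `|g x i| <= M.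

Definition history (Omega : Type) (X : R -> Omega -> R)
    (Y : R -> Omega -> 'I_2) (s : R) : set (set Omega) :=
  <<s [set A | exists u, 0 <= u <= s /\
        ((exists2 B, measurable B & A = X u @^-1` B) \/
         (exists j, A = Y u @^-1` [set j]))] >>.

(* A cadlag time-homogeneous Markov process (for its own filtration), with
   initial law nu and generator B. Time is indexed by R; only t >= 0 matters.
   [cp_markov] is E[g(X(s+t), Y(s+t)) | history up to s] = T_t g (X(s), Y(s));
   [cp_generator] says that f(X(t), Y(t)) - int_0^t Bf(X(u), Y(u)) du is a
   martingale for every test function f. *)
Record coupled_process d (Omega : measurableType d) (P : probability Omega R)
    (F : {mfun R >-> R}) (eps lam : R) (eta : R -> R) (xi p : 'I_2 -> R)
    (X : R -> Omega -> R) (Y : R -> Omega -> 'I_2) : Prop := {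
  cp_measX : forall t, 0 <= t -> measurable_fun setT (X t) ;
  cp_measY : forall t j, 0 <= t -> measurable (Y t @^-1` [set j]) ;
  cp_rightX : forall w t, 0 <= t -> X u w @[u --> t^'+] --> X t w ;
  cp_leftX : forall w t, 0 < t -> cvg (X u w @[u --> t^'-]) ;
  cp_rightY : forall w t, 0 <= t -> \forall u \near t^'+, Y u w = Y t w ;
  cp_leftY : forall w t, 0 < t ->
    exists j, \forall u \near t^'-, Y u w = j ;
  cp_init : forall i (G : set R), measurable G ->
    P (X 0 @^-1` G `&` Y 0 @^-1` [set i])
    = (p i * \int[varpi F eps]_(x in G) alpha eta xi i x)%:E ;
  cp_markov : exists T : R -> (R -> 'I_2 -> R) -> (R -> 'I_2 -> R),
    forall t g, 0 <= t -> bounded_measurable g ->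
      bounded_measurable (T t g) /\
      forall s A, 0 <= s -> history X Y s A ->
        \int[P]_(w in A) g (X (s + t) w) (Y (s + t) w)
        = \int[P]_(w in A) T t g (X s w) (Y s w) ;
  cp_generator : forall f s t A, test_function f -> 0 <= s -> s <= t ->
    history X Y s A ->
    \int[P]_(w in A) (f (X t w) (Y t w) - f (X s w) (Y s w))
    = \int[P]_(w in A) \int[lebesgue_measure]_(u in `[s, t])
        genB F eps lam eta xi f (X u w) (Y u w)
}.

(* E[g(X(t)) | Y(t) = j]; on a null event the conditional law of X(t) is, by
   convention, alpha_j d varpi. *)
Definition cond_expect d (Omega : measurableType d) (P : probability Omega R)
    (F : {mfun R >-> R}) (eps : R) (eta : R -> R) (xi : 'I_2 -> R)
    (X : R -> Omega -> R) (Y : R -> Omega -> 'I_2)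
    (t : R) (j : 'I_2) (g : R -> R) : R :=
  if P (Y t @^-1` [set j]) == 0%E then
    \int[varpi F eps]_x (g x * alpha eta xi j x)
  else
    (\int[P]_(w in Y t @^-1` [set j]) g (X t w))
    / fine (P (Y t @^-1` [set j])).

Definition cond_prob d (Omega : measurableType d) (P : probability Omega R)
    (F : {mfun R >-> R}) (eps : R) (eta : R -> R) (xi : 'I_2 -> R)
    (X : R -> Omega -> R) (Y : R -> Omega -> 'I_2)
    (t : R) (j : 'I_2) (G : set R) : R :=
  cond_expect P F eps eta xi X Y t j \1_G.

(* E^varpi[g(X(0)) | X(0) < 0] *)
Definition left_expect (F : {mfun R >-> R}) (eps : R) (g : R -> R) : R :=
  (\int[varpi F eps]_(x in `]-oo, 0[) g x) / fine (varpi F eps `]-oo, 0[%classic).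

End coupling.

(* Main.v *)
Require Import Defs.
From mathcomp Require Import all_boot all_order all_algebra.
From mathcomp Require Import all_classical all_reals all_analysis.
From mathcomp Require Import measurable_realfun.
From mathcomp Require Import ring lra.

Set Implicit Arguments.
Unset Strict Implicit.
Unset Printing Implicit Defensive.

Import Order.TTheory GRing.Theory Num.Theory.
Import numFieldNormedType.Exports.

Local Open Scope classical_set_scope.
Local Open Scope ring_scope.

(* Write w = exp(-F/eps), H = -eta(-oo) and u = w eta'. The eigenvalue equation
   reads u' = -(lam/eps) eta w, with u >= 0 and u -> 0 at -oo. By the conditional
   law, E[g(X(t)) | Y(t) = 0] is the varpi-integral of g plus xi_0 times that of
   g eta, while varpi puts mass 1 - O(eps) on the half-line x < 0.
   Hence (a) implies (b): integrating the equation gives int eta dvarpi <= 0, and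
   |eta| <= eta + 2 H, so |xi_0 int g eta dvarpi| <= 2 sup|g| |xi_0| H.
   (b) with the indicator of x < 0 is (1).
   For (1) implies (a), it suffices that -int_(x < 0) eta dvarpi is at least a
   fixed fraction of H. From u' <= (lam/eps) H w one gets u <= (lam/eps) H k w
   left of x0, where k is integrable at -oo by the growth of F', so that
   eta + H = O((lam/eps) H) there; between x0 and 0, where F increases, eta w
   can be large only by O((lam/eps) H mu(x < 0)). Finally lam/eps -> 0, by a
   Muckenhoupt-type bound on the side of 0 that does not contain the zero of
   eta. *)

(** * Calculus on the line: comparison of increments through derivatives *)

Section real_functions.
Variable R : realType.
Implicit Types (f df g dg : R -> R) (a b c k x : R).

Lemma is_derive_continuous f df :
  (forall x, is_derive x 1 f (df x)) -> continuous f.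
Proof.
move=> fdf x; apply: differentiable_continuous.
by apply/derivable1_diffP; have [] := fdf x.
Qed.

Lemma derivable_is_derive f x : derivable f x 1 -> is_derive x 1 f (derive1 f x).
Proof. by move=> fx; rewrite derive1E; exact: derivableP. Qed.

(** The mean value theorem for [g - f]. Comparing the derivatives only inside the interval gives
    bounds up to its endpoints; with a power or a multiple of [weight] as [g], this becomes a
    supersolution argument. *)
Lemma le_increment f df g dg a b :
  (forall x, a <= x <= b -> is_derive x 1 f (df x)) ->
  (forall x, a <= x <= b -> is_derive x 1 g (dg x)) ->
  a <= b -> (forall x, a < x < b -> df x <= dg x) -> f b - f a <= g b - g a.
Proof.
move=> fdf gdg; rewrite le_eqVlt => /predU1P[-> _|ab dfg].
  by rewrite !subrr.
have hd x : a <= x <= b -> is_derive x 1 (g - f) (dg x - df x).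
  by move=> xab; apply: is_deriveB; [exact: gdg|exact: fdf].
have hd' x : x \in `]a, b[ -> is_derive x 1 (g - f) (dg x - df x).
  by rewrite in_itv/= => /andP[ax xb]; apply: hd; rewrite !ltW.
have [|c] := MVT ab hd'.
  apply: continuous_in_subspaceT => x; rewrite inE/= in_itv/= => xab.
  apply: differentiable_continuous.
  by apply/derivable1_diffP; have [] := hd x xab.
rewrite in_itv/= => cab; rewrite !fctE => h.
have : 0 <= (dg c - df c) * (b - a).
  by rewrite mulr_ge0// subr_ge0 ?dfg// ltW.
rewrite -h; lra.
Qed.

Lemma is_derive_linear k x : is_derive x 1 (fun y : R => k * y) k.
Proof.
apply: (is_derive_eq (is_deriveZ k (is_derive_id x (1 : R)))).
exact: mulr1.
Qed.

Lemma increment_le f df a b k :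
  (forall x, is_derive x 1 f (df x)) -> a <= b ->
  (forall x, a < x < b -> df x <= k) -> f b - f a <= k * (b - a).
Proof.
move=> fdf ab dfk; rewrite mulrBr.
exact: (le_increment (fun x _ => fdf x) (fun x _ => is_derive_linear k x)).
Qed.

Lemma increment_ge f df a b k :
  (forall x, is_derive x 1 f (df x)) -> a <= b ->
  (forall x, a < x < b -> k <= df x) -> k * (b - a) <= f b - f a.
Proof.
move=> fdf ab dfk; rewrite mulrBr.
exact: (le_increment (fun x _ => is_derive_linear k x) (fun x _ => fdf x)).
Qed.

Lemma le_cvgNy_inf f : {homo f : x y / x <= y} -> has_lbound (range f) ->
  f x @[x --> -oo] --> inf (range f).
Proof.
move=> ndf fl; have fhi : has_inf (range f) by split => //; exists (f 0), 0.
apply/cvgrPdist_le => e e0.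
have [_ [a _ <-] fa] := inf_adherent e0 fhi.
near=> x.
rewrite ler0_norm ?subr_le0; last by apply: ge_inf => //; exists x.
rewrite opprB lerBlDl (le_trans _ (ltW fa))// ndf//.
Unshelve. all: end_near. Qed.

End real_functions.

(** * The eigenvalue equation in flux form *)

Section eigenfunction.
Variables (R : realType) (F : R -> R) (eps lam : R) (eta : R -> R).

Definition weight (x : R) : R := expR (- F x / eps).

(** In Sturm-Liouville form [genA f = eps / weight * (weight * f')'], so [flux] is the quantity
    whose derivative the eigenvalue equation prescribes. *)
Definition flux (x : R) : R := weight x * derive1 eta x.

Lemma weight_gt0 x : 0 < weight x. Proof. exact: expR_gt0. Qed.

Hypotheses (eps0 : 0 < eps) (dF : forall x : R, is_derive x (1 : R) F (derive1 F x)).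

Lemma le_weight x y : F y <= F x -> weight x <= weight y.
Proof. by move=> yx; rewrite ler_expR ler_pM2r ?invr_gt0// lerN2. Qed.

Lemma is_derive_weight (x : R) :
  is_derive x (1 : R) weight (- (derive1 F x / eps) * weight x).
Proof.
have h1 : is_derive x (1 : R) (fun y => - F y / eps) (- (derive1 F x / eps)).
  have -> : (fun y => - F y / eps) = (- eps^-1) \*: F.
    by apply/funext => y /=; rewrite /GRing.scale/=; ring.
  apply: (is_derive_eq (is_deriveZ _ (dF x))).
  by rewrite /GRing.scale/=; ring.
apply: (is_derive_eq (is_derive1_comp (is_derive_expR _) h1)).
by rewrite mulrC.
Qed.

Hypotheses (deta : forall x : R, is_derive x (1 : R) eta (derive1 eta x))
  (deta2 : forall x : R,
    is_derive x (1 : R) (derive1 eta) (derive1 (derive1 eta) x))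
  (ode : forall x, eps * derive1 (derive1 eta) x - derive1 F x * derive1 eta x
                   = - lam * eta x)
  (lam0 : 0 < lam) (eta_incr : {homo eta : x y / x < y}).

Lemma is_derive_flux (x : R) :
  is_derive x (1 : R) flux (lam / eps * (- eta x * weight x)).
Proof.
have h := is_deriveM (is_derive_weight x) (deta2 x).
apply: (is_derive_eq h); rewrite /GRing.scale/=.
(* Once the equation is solved for [eta''], the term in [F'] cancels against the derivative of
   [weight]. *)
have -> : derive1 (derive1 eta) x =
    (derive1 F x * derive1 eta x - lam * eta x) / eps.
  by rewrite -(mulr1 (_ - _)) -[X in _ = X / _](_ : eps * derive1 (derive1 eta) x = _);
    [field; rewrite gt_eqF | move: (ode x); lra].
by field; rewrite gt_eqF.
Qed.

Lemma derive1_eta x : derive1 eta x = flux x * expR (F x / eps).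
Proof. by rewrite /flux mulrAC -expRD mulNr addNr expR0 mul1r. Qed.

Lemma flux_ge0 x : 0 <= flux x.
Proof.
rewrite mulr_ge0 ?expR_ge0//.
apply: (@incr_derive1_ge0_itv _ eta true true (x - 1) (x + 1)).
- by move=> y _; case: (deta y).
- by move=> y z _ _; exact: eta_incr.
- by rewrite in_itv/=; apply/andP; split; lra.
Qed.

Lemma eta_le : {homo eta : x y / x <= y}.
Proof. by move=> x y; rewrite le_eqVlt => /predU1P[->//|/eta_incr/ltW]. Qed.

(** Muckenhoupt-type bound left of the zero [r], where the flux is nondecreasing. Over []a - d, a[]
    it gains at least [lam / eps * |eta a| * expR (- al / eps) * d] and keeps this up to [r]; since
    [eta' = flux * expR (F / eps)], [eta] then climbs by at least [flux a * expR (be / eps) * d]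
    over []b, b + d[]. As [eta <= 0] there, the climb is at most [|eta b| <= |eta a|], and [|eta a|]
    cancels. *)
Lemma rate_le_left (r a b d al be : R) : (forall x, x < r -> eta x < 0) ->
  eta r = 0 -> 0 < d -> a <= b -> b + d <= r ->
  (forall x, a - d < x < a -> F x <= al) ->
  (forall x, b < x < b + d -> be <= F x) ->
  lam / eps * d ^+ 2 <= expR (- ((be - al) / eps)).
Proof.
move=> etaN etar d0 ab bdr Fal Fbe.
have etale0 x : x <= r -> eta x <= 0 by rewrite -etar => /eta_le.
have lr : 0 <= lam / eps by rewrite divr_ge0// ltW.
have ar : eta a < 0 by apply: etaN; lra.
have ua : (lam / eps) * - eta a * expR (- al / eps) * d <= flux a.
  have : (lam / eps) * - eta a * expR (- al / eps) * (a - (a - d))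
      <= flux a - flux (a - d).
    apply: (increment_ge is_derive_flux); first lra.
    move=> x xa; rewrite -[leLHS]mulrA ler_wpM2l//.
    apply: ler_pM; rewrite ?expR_ge0 ?oppr_ge0 ?(ltW ar)//.
      by rewrite lerN2 eta_le//; lra.
    by rewrite ler_expR ler_pM2r ?invr_gt0// lerN2 Fal.
  have := flux_ge0 (a - d); rewrite opprB addrCA subrr addr0; lra.
have uy y : a <= y <= r -> flux a <= flux y.
  move=> /andP[ay yr]; rewrite -subr_ge0 -[leLHS](mul0r (y - a)).
  apply: (increment_ge is_derive_flux) => // x xay.
  rewrite mulr_ge0// mulr_ge0 ?expR_ge0//.
  by rewrite oppr_ge0 etale0//; lra.
have etab : flux a * expR (be / eps) * d <= - eta b.
  have : flux a * expR (be / eps) * (b + d - b) <= eta (b + d) - eta b.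
    apply: (increment_ge deta); first lra.
    move=> x xb; rewrite derive1_eta ler_pM ?flux_ge0 ?expR_ge0//.
      by apply: uy; lra.
    by rewrite ler_expR ler_pM2r ?invr_gt0// Fbe.
  by have := etale0 _ bdr; rewrite (addrC b) addrK; lra.
have etaab : eta a <= eta b by exact: eta_le.
have : lam / eps * - eta a * expR (- al / eps) * d * expR (be / eps) * d
    <= - eta a.
  have etaNab : - eta b <= - eta a by rewrite lerN2.
  apply: (le_trans _ (le_trans etab etaNab)).
  by rewrite ler_wpM2r ?(ltW d0)// ler_wpM2r ?expR_ge0.
have -> : lam / eps * - eta a * expR (- al / eps) * d * expR (be / eps) * d =
    (lam / eps * d ^+ 2) * expR ((be - al) / eps) * - eta a.
  rewrite mulrBl expRD mulNr; ring.
rewrite -[leRHS]mul1r ler_pM2r ?oppr_gt0//.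
by rewrite expRN -ler_pdivlMr ?expR_gt0// mul1r.
Qed.

(** Mirror image: right of [r] the flux is nonincreasing and nonnegative, so what it loses over []a,
    a + d[] bounds it from below at [a], hence on [[r, a]]. *)
Lemma rate_le_right (r a b d al be : R) : eta r = 0 ->
  (forall x, r < x -> 0 < eta x) -> 0 < d -> b <= a -> r <= b - d ->
  (forall x, a < x < a + d -> F x <= al) ->
  (forall x, b - d < x < b -> be <= F x) ->
  lam / eps * d ^+ 2 <= expR (- ((be - al) / eps)).
Proof.
move=> etar etaP d0 ba rbd Fal Fbe.
have etage0 x : r <= x -> 0 <= eta x by rewrite -etar => /eta_le.
have lr : 0 <= lam / eps by rewrite divr_ge0// ltW.
have ar : 0 < eta a by apply: etaP; lra.
have ua : (lam / eps) * eta a * expR (- al / eps) * d <= flux a.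
  have : flux (a + d) - flux a
      <= - ((lam / eps) * eta a * expR (- al / eps)) * (a + d - a).
    apply: (increment_le is_derive_flux); first lra.
    move=> x xa; rewrite mulNr mulrN lerN2 -[leLHS]mulrA ler_wpM2l//.
    apply: ler_pM; rewrite ?expR_ge0 ?(ltW ar)//.
      by rewrite eta_le//; lra.
    by rewrite ler_expR ler_pM2r ?invr_gt0// lerN2 Fal.
  have := flux_ge0 (a + d); rewrite (addrC a d) addrK; lra.
have uy y : r <= y <= a -> flux a <= flux y.
  move=> /andP[ry ya]; rewrite -subr_le0 -[leRHS](mul0r (a - y)).
  apply: (increment_le is_derive_flux) => // x xay.
  rewrite mulNr mulrN oppr_le0 mulr_ge0// mulr_ge0 ?expR_ge0//.
  by rewrite etage0//; lra.
have etab : flux a * expR (be / eps) * d <= eta b.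
  have : flux a * expR (be / eps) * (b - (b - d)) <= eta b - eta (b - d).
    apply: (increment_ge deta); first lra.
    move=> x xb; rewrite derive1_eta ler_pM ?flux_ge0 ?expR_ge0//.
      by apply: uy; lra.
    by rewrite ler_expR ler_pM2r ?invr_gt0// Fbe.
  by have := etage0 _ rbd; rewrite opprB addrCA subrr addr0; lra.
have etaab : eta b <= eta a by exact: eta_le.
have : lam / eps * eta a * expR (- al / eps) * d * expR (be / eps) * d
    <= eta a.
  apply: (le_trans _ (le_trans etab etaab)).
  by rewrite ler_wpM2r ?(ltW d0)// ler_wpM2r ?expR_ge0.
have -> : lam / eps * eta a * expR (- al / eps) * d * expR (be / eps) * d =
    (lam / eps * d ^+ 2) * expR ((be - al) / eps) * eta a.
  rewrite mulrBl expRD mulNr; ring.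
rewrite -[leRHS]mul1r ler_pM2r//.
by rewrite expRN -ler_pdivlMr ?expR_gt0// mul1r.
Qed.

(* If the flux did not vanish at [-oo], [eta'] would stay bounded away from 0
   there, and [eta] would be unbounded. *)
Lemma flux_small (r A : R) : (forall x, x < r -> eta x < 0) ->
  (forall x, x <= A -> 0 <= F x) -> has_lbound (range eta) ->
  forall e, 0 < e -> exists B, forall x, x <= B -> flux x <= e.
Proof.
move=> etaN FA [m etam] e e0; apply: contrapT => /forallNP noB.
(* Left of [B] one has [eta < 0], so that the flux is nondecreasing, and [F >= 0], so that
   [eta' >= flux]. *)
pose B := Num.min (Num.min r A) 0.
have Bs : [/\ B <= r, B <= A & B <= 0] by rewrite /B !ge_min !lexx !orbT.
case: Bs => Br BA B0.
have ue x : x <= B -> e <= flux x.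
  move=> xB; have /existsNP[y /not_implyP[yx /negP]] := noB x.
  rewrite -ltNge => /ltW ey; apply: (le_trans ey).
  rewrite -subr_ge0 -[leLHS](mul0r (x - y)).
  apply: (increment_ge is_derive_flux) => // z zxy.
  rewrite mulr_ge0 ?divr_ge0 ?(ltW lam0) ?(ltW eps0)// mulr_ge0 ?expR_ge0//.
  by rewrite oppr_ge0 ltW// etaN//; lra.
(* This choice gives [e * (B - y) = eta B - m + e], an increment larger by [e] than the lower bound
   [m] allows. *)
pose y := B - ((eta B - m) / e + 1).
have etaBm : m <= eta B by apply: etam; exists B.
have yB : y <= B.
  by rewrite gerBl addr_ge0// divr_ge0 ?subr_ge0// ltW.
have : e * (B - y) <= eta B - eta y.
  apply: (increment_ge deta) => // x xy.
  rewrite derive1_eta -[leLHS]mulr1 ler_pM ?(ltW e0)//.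
    by apply: ue; lra.
  have F0 : 0 <= F x by apply: FA; lra.
  by rewrite -[leLHS]expR0 ler_expR divr_ge0// ltW.
have -> : e * (B - y) = eta B - m + e.
  by rewrite /y opprB addrCA subrr addr0 mulrDr mulr1 mulrC divfK ?gt_eqF.
have : m <= eta y by apply: etam; exists y.
lra.
Qed.

(** * Upper bounds for the eigenfunction left of the barrier *)

Hypotheses (eta_lb : has_lbound (range eta))
  (flux_small0 : forall e, 0 < e -> exists B, forall x, x <= B -> flux x <= e).

(** As [eta] increases, [- H] is its limit at minus infinity; since [eta >= - H], the slope of the
    flux is at most [c * weight]. *)
Let H := - inf (range eta).
Variable c : R.
Hypothesis cE : c = lam / eps * H.

Lemma eta_ge_inf x : - H <= eta x.
Proof. by rewrite opprK; apply: ge_inf => //; exists x. Qed.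

Lemma inf_eta_ge (x0 m : R) : (forall x, x <= x0 -> m <= eta x) -> m <= - H.
Proof.
move=> etam; rewrite opprK; apply: lb_le_inf; first by exists (eta 0), 0.
move=> _ [x _ <-]; rewrite (le_trans (etam (Num.min x x0) _))//.
  by rewrite ge_min lexx orbT.
by apply: eta_le; rewrite ge_min lexx.
Qed.

Lemma rate_ge0 : 0 <= lam / eps. Proof. by rewrite divr_ge0// ltW. Qed.

Lemma flux_slope_le x : lam / eps * (- eta x * weight x) <= c * weight x.
Proof.
rewrite cE -(mulrA (lam / eps)) ler_wpM2l ?rate_ge0// ler_wpM2r ?expR_ge0//.
by rewrite lerNl eta_ge_inf.
Qed.

(* [k * weight] is a supersolution of [y' = weight] wherever
   [F' <= - eps / k]. *)
Lemma flux_le_tail k y : 0 <= c -> 0 <= k ->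
  (forall z, z <= y -> 1 <= k * (- derive1 F z / eps)) ->
  flux y <= c * k * weight y.
Proof.
(* The comparison starts from a point [x] with [flux x <= e]; the term [c * k * weight x] is
   nonnegative and [e] is arbitrary. *)
move=> c0 k0 kF; apply/ler_addgt0Pr => e /flux_small0[B Bu].
pose x := Num.min B y.
have [xB xy] : x <= B /\ x <= y by rewrite /x !ge_min !lexx orbT.
have hw z : is_derive z (1 : R) ((c * k) \*: weight)
    (c * k * (- (derive1 F z / eps) * weight z)).
  exact: (is_derive_eq (is_deriveZ (c * k) (is_derive_weight z))).
have : flux y - flux x <= c * k * weight y - c * k * weight x.
  apply: (le_increment (fun z _ => is_derive_flux z) (fun z _ => hw z) xy).
  move=> z /andP[_ zy]; apply: (le_trans (flux_slope_le z)).
  rewrite -(mulrA c) ler_wpM2l// mulrA -[leLHS]mul1r ler_wpM2r ?expR_ge0//.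
  by rewrite -mulNr kF// ltW.
have : 0 <= c * k * weight x by rewrite !mulr_ge0// ltW// weight_gt0.
have := Bu _ xB; lra.
Qed.

Lemma derive1_eta_le k x : flux x <= k * weight x -> derive1 eta x <= k.
Proof. by rewrite /flux mulrC ler_pM2r// weight_gt0. Qed.

(** Left of [- a] the growth of [F'] bounds [eta'] at [y] by [c * C] times the power [- (s + 1)] of
    [- y], integrable because [s > 0]. Between [- a] and [x0] the weight is nondecreasing, so
    [eta' = flux / weight] stays bounded. The two increments add up to the bound. *)
Lemma eta_left_le (x0 a s C : R) : 0 <= c -> 0 < s -> 0 < C -> 0 < a ->
  - a <= x0 -> eps <= 1 ->
  (forall z, z <= - a -> (- z) `^ (s + 1) <= C * - derive1 F z) ->
  (forall x y, x <= y <= x0 -> F y <= F x) ->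
  eta x0 + H <= c * (C / s * a `^ (- s)
                     + (x0 + a) * (C * a `^ (- (s + 1)) + (x0 + a))).
Proof.
move=> c0 s0 C0 a0 ax0 eps1 Fgrowth Fdec.
pose phi y := C * (- y) `^ (- (s + 1)).
have phi0 y : 0 <= phi y by rewrite mulr_ge0 ?powR_ge0// ltW.
have tail y : y <= - a -> flux y <= c * phi y * weight y.
  move=> ya; apply: flux_le_tail => // z zy.
  have y0 : 0 < - y by lra.
  have Fz : (- y) `^ (s + 1) <= C * - derive1 F z.
    apply: le_trans (Fgrowth z _); last lra.
    by apply: ge0_ler_powR; rewrite ?nnegrE; lra.
  have Fz0 : 0 < - derive1 F z.
    by rewrite -(pmulr_rgt0 _ C0) (lt_le_trans _ Fz)// powR_gt0.
  rewrite /phi powRN.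
  apply: (@le_trans _ _ (C * ((- y) `^ (s + 1))^-1 * - derive1 F z)).
    by rewrite mulrAC ler_pdivlMr ?powR_gt0// mul1r.
  (* Since [eps <= 1], dividing [- F' z > 0] by [eps] does not decrease it. *)
  rewrite ler_wpM2l ?mulr_ge0 ?invr_ge0 ?powR_ge0 ?(ltW C0)//.
  by rewrite ler_pdivlMr// ler_piMr// ltW.
have dPhi (y : R) : y < 0 ->
    is_derive y (1 : R) ((c * (C / s)) \*: (fun z => (- z) `^ (- s)))
      (c * phi y).
  move=> y0; have Ny0 : 0 < - y by lra.
  have h := is_deriveZ (c * (C / s)) (is_derive1_comp
    (is_derive1_powR (- s) Ny0) (is_deriveN (is_derive_id y (1 : R)))).
  apply: (is_derive_eq h); rewrite /phi opprD /GRing.scale/=.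
  by field; rewrite gt_eqF.
(* The antiderivative of [c * phi] is nonnegative at [x], so the bound on [eta (- a) - eta x] can be
   made independent of [x] and passes to the infimum. *)
have etaa : eta (- a) - c * (C / s) * a `^ (- s) <= - H.
  apply: (@inf_eta_ge (- a)) => x xa.
  have : eta (- a) - eta x <= c * (C / s) * (- - a) `^ (- s)
                              - c * (C / s) * (- x) `^ (- s).
    have neg z : x <= z <= - a -> z < 0 by lra.
    apply: (le_increment (fun z _ => deta z) (fun z h => dPhi z (neg z h)) xa).
    move=> z xza; apply: derive1_eta_le; apply: tail; lra.
  have : 0 <= c * (C / s) * (- x) `^ (- s).
    by rewrite !mulr_ge0 ?powR_ge0 ?invr_ge0// ltW.
  rewrite opprK; lra.
have core y : - a <= y <= x0 ->
    flux y <= c * (phi (- a) + (x0 + a)) * weight y.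
  move=> /andP[ay yx0].
  have wy z : z <= y -> weight z <= weight y.
    by move=> zy; apply: le_weight; apply: Fdec; rewrite zy.
  have : flux y - flux (- a) <= c * weight y * (y - - a).
    apply: (increment_le is_derive_flux) => // z zy.
    apply: (le_trans (flux_slope_le z)).
    by rewrite ler_wpM2l// wy// ltW; case/andP: zy.
  have : c * phi (- a) * weight (- a) <= c * phi (- a) * weight y.
    by rewrite ler_wpM2l ?wy// mulr_ge0.
  have := tail _ (lexx (- a)).
  have : c * weight y * (y - - a) <= c * weight y * (x0 + a).
    by rewrite ler_wpM2l ?mulr_ge0 ?(ltW (weight_gt0 _))//; lra.
  lra.
have : eta x0 - eta (- a) <= c * (phi (- a) + (x0 + a)) * (x0 - - a).
  apply: (increment_le deta) => // z za; apply: derive1_eta_le.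
  by apply: core; lra.
rewrite /phi opprK; move: etaa.
set A := a `^ _; set B := a `^ _; lra.
Qed.

(** On [[x0, x]] the factor [expR (F / eps)] of [eta'] is largest at [x], where it equals
    [1 / weight x]; multiplied by [weight x], the rise of [eta] is thus at most
    [c * m * (x - x0)]. *)
Lemma eta_right_le (x0 x m : R) : x0 <= x ->
  (forall y, y <= x -> flux y <= c * m) -> 0 <= c * m ->
  (forall y, x0 <= y <= x -> F y <= F x) ->
  eta x <= eta x0 + c * m * (x - x0) * expR (F x / eps).
Proof.
move=> x0x um m0 Finc.
have : eta x - eta x0 <= c * m * expR (F x / eps) * (x - x0).
  apply: (increment_le deta) => // y yx; rewrite derive1_eta.
  rewrite ler_pM ?flux_ge0 ?expR_ge0 ?um//; first lra.
  by rewrite ler_expR ler_pM2r ?invr_gt0// Finc//; lra.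
lra.
Qed.

End eigenfunction.

(** * Shape and growth of the double-well potential *)

Section double_well_potential.
Variable R : realType.

(** If [a1 > a2], the inequality fails at the [t >= 1] whose power [a1 - a2] is [1 + K]. Combined
    with [a2 < 2 * a1 - 2], the order of the exponents yields [a1 > 2]. *)
Lemma powR_exponent_le (a1 a2 c1 c2 c3 c4 : R) :
  0 < a2 -> 0 < c1 -> 0 < c2 -> 0 < c3 -> 0 < c4 ->
  (forall x : R, c1 * `|x| `^ a1 - c2 <= c3 * `|x| `^ a2 + c4) -> a1 <= a2.
Proof.
move=> a20 c10 c20 c30 c40 h; rewrite leNgt; apply/negP => a21.
have b0 : 0 < a1 - a2 by rewrite subr_gt0.
pose K := (c2 + c3 + c4 + 1) / c1.
have K0 : 0 < K by rewrite divr_gt0//; lra.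
pose t := (1 + K) `^ (a1 - a2)^-1.
have t1 : 1 <= t.
  by rewrite -[leLHS](powRr0 (1 + K)); apply: ler_powR; [lra|rewrite invr_ge0 ltW].
have t0 : 0 < t by lra.
have tE : t `^ a1 = (1 + K) * t `^ a2.
  rewrite -[X in X * _](_ : t `^ (a1 - a2) = _).
    by rewrite -powRD ?subrK// (gt_eqF t0) implybT.
  by rewrite -powRrM mulVf ?gt_eqF// powRr1//; lra.
have ta2 : 1 <= t `^ a2.
  by rewrite -[leLHS](powRr0 t); apply: ler_powR => //; exact: ltW.
have := h t; rewrite gtr0_norm// tE.
have -> : c1 * ((1 + K) * t `^ a2)
    = (c1 + (c2 + c3 + c4 + 1)) * t `^ a2.
  by rewrite /K; field; rewrite gt_eqF.
nra.
Qed.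

Lemma continuous_near_lt (f : R -> R) x k : continuous f -> f x < k ->
  exists2 d, 0 < d & forall y, `|x - y| < d -> f y < k.
Proof.
move=> cf fxk; have : \forall y \near x, f y < k.
  exact: cvgr_lt (f x) (cf x) k fxk.
by move/nbhs_ballP => [d d0 fd]; exists d => // y xy; apply: fd.
Qed.

Variables (F : R -> R) (x0 x1 : R).
Hypothesis F_dw : double_well F x0 x1.
Hypothesis F_wells : F x0 < F x1.

Lemma dw_is_derive x : is_derive x (1 : R) F (derive1 F x).
Proof. by apply: derivable_is_derive; exact: (dw_derivable F_dw (k := 0)). Qed.

Lemma dw_continuous : continuous F.
Proof. exact: is_derive_continuous dw_is_derive. Qed.

Lemma dw_left_lt0 : x0 < 0.
Proof. by have /andP[] := dw_order F_dw. Qed.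
Lemma dw_right_gt0 : 0 < x1.
Proof. by have /andP[] := dw_order F_dw. Qed.

Lemma dw_derive1_left x : x < x0 -> derive1 F x <= 0.
Proof.
move=> xx0; apply: (@decr_derive1_le0_itvNy _ F true x0).
- by move=> y _; case: (dw_is_derive y).
- exact: dw_decr_left F_dw.
- by rewrite in_itv.
Qed.

Lemma dw_derive1_right x : x1 < x -> 0 <= derive1 F x.
Proof.
move=> xx1; apply: (@incr_derive1_ge0_itvy _ F false x1).
- by move=> y _; case: (dw_is_derive y).
- exact: dw_incr_right F_dw.
- by rewrite in_itv/= xx1.
Qed.

(** Monotonicity is assumed on an open half-line; working with the sign of [F'] brings in the
    endpoint [x0]. *)
Lemma dw_nincr_left x y : x <= y <= x0 -> F y <= F x.
Proof.
move=> /andP[xy yx0]; rewrite -subr_le0 -[leRHS](mul0r (y - x)).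
by apply: (increment_le dw_is_derive) => // z zy; apply: dw_derive1_left; lra.
Qed.

Lemma dw_nincr_right x y : 0 <= x -> x <= y <= x1 -> F y <= F x.
Proof.
have x00 := dw_left_lt0; have x10 := dw_right_gt0.
move=> x_ge0 /andP[xy yx1]; rewrite -subr_le0 -[leRHS](mul0r (y - x)).
apply: (increment_le dw_is_derive) => // z zy.
apply: (@decr_derive1_le0_itv _ F false true 0 x1).
- by move=> t _; case: (dw_is_derive t).
- exact: dw_decr_right F_dw.
- by rewrite in_itv/=; lra.
Qed.

Lemma dw_ndecr_left x y : x0 <= x <= y -> y <= 0 -> F x <= F y.
Proof.
have x00 := dw_left_lt0; have x10 := dw_right_gt0.
move=> /andP[xx0 xy] y0; rewrite -subr_ge0 -[leLHS](mul0r (y - x)).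
apply: (increment_ge dw_is_derive) => // z zy.
apply: (@incr_derive1_ge0_itv _ F false true x0 0).
- by move=> t _; case: (dw_is_derive t).
- exact: dw_incr_left F_dw.
- by rewrite in_itv/=; lra.
Qed.

Lemma dw_ndecr_right x y : x1 <= x <= y -> F x <= F y.
Proof.
move=> /andP[xx1 xy]; rewrite -subr_ge0 -[leLHS](mul0r (y - x)).
by apply: (increment_ge dw_is_derive) => // z zy; apply: dw_derive1_right; lra.
Qed.

(** Strict decrease is assumed only inside []0, x1[], so a strict step between [x1 / 3] and
    [x1 * 2 / 3] is joined to weak inequalities at the ends. *)
Lemma dw_barrier : F x1 < F 0.
Proof.
have x00 := dw_left_lt0; have x10 := dw_right_gt0.
have h : F (x1 * 2 / 3) < F (x1 / 3).
  by apply: (dw_decr_right F_dw); rewrite ?in_itv/=; lra.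
have : F (x1 / 3) <= F 0 by apply: dw_nincr_right => //; lra.
have : F x1 <= F (x1 * 2 / 3) by apply: dw_nincr_right => //; lra.
lra.
Qed.

Lemma dw_min_right x : 0 <= x -> F x1 <= F x.
Proof.
move=> x_ge0; have [xx1|x1x] := leP x x1.
  by apply: dw_nincr_right => //; rewrite xx1 lexx.
by apply: dw_ndecr_right; rewrite lexx ltW.
Qed.

Lemma dw_min x : F x0 <= F x.
Proof.
have [x_le0|x_gt0] := leP x 0; last first.
  by rewrite (le_trans (ltW F_wells))// dw_min_right// ltW.
have [xx0|x0x] := leP x x0; first by apply: dw_nincr_left; rewrite xx0 lexx.
by apply: dw_ndecr_left => //; rewrite lexx ltW.
Qed.

(** The exponent [s + 1 > 1] makes [1 / |F'|] integrable at minus infinity, which controls [eta] in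
    the tail. *)
Lemma dw_growth_powR : exists s C a, [/\ 0 < s, 0 < C, 0 < a &
  forall x, a <= `|x| -> `|x| `^ (s + 1) <= C * `|derive1 F x|].
Proof.
have [a1 [a2 [c1 [c2 [c3 [c4 [[a10 a20 c10 c20 [c30 c40]] a21 gr _]]]]]]] :=
  dw_growth F_dw.
have a12 : a1 <= a2.
  apply: (@powR_exponent_le a1 a2 c1 c2 c3 c4) => // x.
  by have /andP[] := gr x; exact: le_trans.
(* [a1 > 2] makes [s] positive. Beyond [a], [c2] is at most half of the leading term, so the other
   half bounds the square of [F'] from below; hence the 2 in [C]. *)
pose s := a1 / 2 - 1; pose C := Num.sqrt (2 / c1).
pose a := (2 * c2 / c1) `^ a1^-1.
have s0 : 0 < s by rewrite /s; lra.
have C0 : 0 < C by rewrite sqrtr_gt0 divr_gt0.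
have a0 : 0 < a by rewrite powR_gt0// divr_gt0// mulr_gt0.
exists s, C, a; split => // x ax.
rewrite -ler_sqr ?nnegrE ?powR_ge0//; last by rewrite mulr_ge0// ltW.
rewrite exprMn sqr_sqrtr; last by rewrite divr_ge0// ltW.
have -> : (`|x| `^ (s + 1)) ^+ 2 = `|x| `^ a1.
  rewrite -powR_mulrn ?powR_ge0// -powRrM; congr (_ `^ _).
  by rewrite /s; lra.
have ha : 2 * c2 / c1 <= `|x| `^ a1.
  rewrite -[leLHS](_ : a `^ a1 = _); last first.
    by rewrite -powRrM mulVf ?gt_eqF// powRr1// divr_ge0 ?mulr_ge0// ltW.
  by apply: ge0_ler_powR => //; rewrite ?nnegrE ltW.
have /andP[h _] := gr x.
rewrite mulrAC ler_pdivlMr//.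
move: ha; rewrite ler_pdivrMr//; lra.
Qed.

(** Beyond the wells [F] increases outwards, and far out its slope is at least 1 in absolute value.
    This linear growth makes [weight] integrable. *)
Lemma dw_coercive : exists K, forall x, `|x| - K <= F x.
Proof.
have x00 := dw_left_lt0; have x10 := dw_right_gt0.
have [s [C [a [s0 C0 a0 gr]]]] := dw_growth_powR.
(* [b] lies beyond both wells and beyond [a]; for [|x| >= b], the bounds [b >= C] and [b >= 1] give
   [C <= |x| <= C * |F'|]. *)
pose b := Num.max (Num.max a C) (Num.max 1 (Num.max (1 - x0) (x1 + 1))).
have [ba bC b1 bx0 bx1] :
    [/\ a <= b, C <= b, 1 <= b, 1 - x0 <= b & x1 + 1 <= b].
  by rewrite /b !le_max !lexx !orbT.
have F1 x : b <= `|x| -> 1 <= `|derive1 F x|.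
  move=> bx; have := gr x (le_trans ba bx).
  have : `|x| `^ 1 <= `|x| `^ (s + 1) by apply: ler_powR; lra.
  rewrite powRr1// => xs sC; have : C * 1 <= C * `|derive1 F x| by lra.
  by rewrite ler_pM2l.
exists (b - F x0) => x.
have [xb|bx] := ltP x (- b).
  have : F (- b) - F x <= - 1 * (- b - x).
    apply: (increment_le dw_is_derive); first exact: ltW.
    move=> z zx; have := F1 z; have := @dw_derive1_left z.
    by move=> /(_ ltac:(lra)) Fz; rewrite !ler0_norm//; lra.
  by have := dw_min (- b); rewrite ltr0_norm; lra.
have [xb|{}xb] := ltP b x.
  have : 1 * (x - b) <= F x - F b.
    apply: (increment_ge dw_is_derive); first exact: ltW.
    move=> z zx; have := F1 z; have := @dw_derive1_right z.
    by move=> /(_ ltac:(lra)) Fz; rewrite !ger0_norm//; lra.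
  by have := dw_min b; rewrite gtr0_norm; lra.
have : `|x| <= b by rewrite ler_norml bx.
have := dw_min x; lra.
Qed.

(** One pair of levels serves both wells, since [F x0 < F x1 < F 0]. A third of the gap [F 0 - F x1]
    is left on either side, and continuity provides [d]. *)
Lemma dw_levels : exists d al be, [/\ 0 < d, d <= - x0 /\ d <= x1, al < be &
  [/\ forall x, x0 - d < x < x0 -> F x <= al,
      forall x, x1 < x < x1 + d -> F x <= al,
      forall x, - d < x < 0 -> be <= F x
    & forall x, 0 < x < d -> be <= F x]].
Proof.
have x00 := dw_left_lt0; have x10 := dw_right_gt0.
have F01 := dw_barrier; have Fw := F_wells.
pose g := F 0 - F x1; have g0 : 0 < g by rewrite subr_gt0.
pose al := F x1 + g / 3; pose be := F 0 - g / 3.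
have [d0 d00 h0] : exists2 d, 0 < d & forall y, `|x0 - y| < d -> F y < al.
  by apply: continuous_near_lt; [exact: dw_continuous|rewrite /al; lra].
have [d1 d10 h1] : exists2 d, 0 < d & forall y, `|x1 - y| < d -> F y < al.
  by apply: continuous_near_lt; [exact: dw_continuous|rewrite /al; lra].
have [d2 d20 h2] : exists2 d, 0 < d & forall y, `|0 - y| < d -> - F y < - be.
  apply: (@continuous_near_lt (fun y => - F y)); last by rewrite /be; lra.
  by move=> y; apply: cvgN; exact: dw_continuous.
have [d [dpos dd0 dd1 dd2 [dx0 dx1]]] : exists d : R,
    [/\ 0 < d, d <= d0, d <= d1, d <= d2 & d <= - x0 /\ d <= x1].
  exists (Num.min (Num.min d0 d1) (Num.min d2 (Num.min (- x0) x1))).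
  by rewrite !lt_min d00 d10 d20 oppr_gt0 x00 x10 !ge_min !lexx !orbT.
exists d, al, be; split => //.
- by rewrite /al /be /g; lra.
- split=> x xd.
  + by apply/ltW/h0; rewrite ltr_norml; lra.
  + by apply/ltW/h1; rewrite ltr_norml; lra.
  + by rewrite -lerN2 ltW// h2// ltr_norml; lra.
  + by rewrite -lerN2 ltW// h2// ltr_norml; lra.
Qed.

End double_well_potential.

(** * Integration against a measure given by a density *)

(* The two measures may live on different measurable types because the domain of
   [lebesgue_measure] is a generated sigma-algebra, only convertible to the
   canonical structure on [R]; there [phi] is the identity. *)
Section density.
Context d1 d2 (T1 : measurableType d1) (T2 : measurableType d2) (R : realType).
Variables (m : {measure set T1 -> \bar R}) (nu : {measure set T2 -> \bar R}).
Variables (phi : T1 -> T2) (f : T1 -> R).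
Hypotheses (mphi : measurable_fun setT phi) (mf : measurable_fun setT f)
  (f0 : forall x, 0 <= f x)
  (nuE : forall A, measurable A ->
    nu A = (\int[m]_(x in phi @^-1` A) (f x)%:E)%E).

Let measurable_preimage D : measurable D -> measurable (phi @^-1` D).
Proof. by move=> mD; rewrite -[X in measurable X]setTI; exact: mphi. Qed.

Import HBNNSimple.

Let integral_density_indic D A : measurable D -> measurable A ->
  (\int[nu]_(x in D) (\1_A x)%:E = \int[m]_(x in phi @^-1` D) (\1_A (phi x) * f x)%:E)%E.
Proof.
move=> mD mA; rewrite integral_indic// nuE; last exact: measurableI.
rewrite setIC preimage_setI integral_mkcondr; apply: eq_integral => x _.
rewrite patchE indicE -[x \in _]/(phi x \in A).
by case: (phi x \in A); rewrite ?mul1r ?mul0r.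
Qed.

Let integral_density_nnsfun D (h : {nnsfun T2 >-> R}) : measurable D ->
  (\int[nu]_(x in D) (h x)%:E = \int[m]_(x in phi @^-1` D) (h (phi x) * f x)%:E)%E.
Proof.
move=> mD; have mD' := measurable_preimage mD.
have mh (y : R) : measurable (h @^-1` [set y]) by exact: measurable_sfunP.
have h0 (y x : T2) : 0 <= h y * \1_(h @^-1` [set h y]) x by rewrite mulr_ge0.
have mi (y : R) : measurable_fun D (fun x => \1_(h @^-1` [set y]) x : R).
  exact: measurable_indic.
have mi' (y : R) :
    measurable_fun (phi @^-1` D) (fun x => \1_(h @^-1` [set y]) (phi x) : R).
  apply: measurable_funTS; apply: measurableT_comp mphi.
  exact: measurable_indic.
under eq_integral do rewrite fimfunE -fsumEFin//.
rewrite ge0_integral_fsum//; last 2 first.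
- by move=> y; apply/measurable_EFinP; exact: measurable_funM.
- by move=> y x _; rewrite EFinM nnfun_muleindic_ge0.
under [RHS]eq_integral.
  move=> x _; rewrite EFinM fimfunE -fsumEFin// ge0_mule_fsuml; last first.
    by move=> y; rewrite EFinM nnfun_muleindic_ge0.
  over.
rewrite [RHS]ge0_integral_fsum//; last 2 first.
- move=> y; apply/measurable_EFinP; apply: measurable_funM.
    exact: measurable_funM.
  exact: measurable_funTS.
- move=> y x _; apply: mule_ge0; last by rewrite lee_fin.
  by rewrite EFinM nnfun_muleindic_ge0.
apply: eq_fsbigr => y /[!inE] -[t _ <-].
under [LHS]eq_integral do rewrite EFinM.
under [RHS]eq_integral do rewrite -EFinM -mulrA EFinM.
rewrite [LHS]ge0_integralZl_EFin ?[RHS]ge0_integralZl_EFin//.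
- by rewrite integral_density_indic.
- by move=> x _; rewrite lee_fin mulr_ge0.
- by apply/measurable_EFinP; apply: measurable_funM => //; exact: measurable_funTS.
- exact/measurable_EFinP.
Qed.

Let ge0_integral_density D (g : T2 -> R) : measurable D ->
  measurable_fun setT g -> (forall x, 0 <= g x) ->
  (\int[nu]_(x in D) (g x)%:E
   = \int[m]_(x in phi @^-1` D) (g (phi x) * f x)%:E)%E.
Proof.
move=> mD mg g0; have mD' := measurable_preimage mD.
have mgD : measurable_fun D (EFin \o g).
  by apply/measurable_EFinP; exact: measurable_funTS.
pose h := nnsfun_approx mD mgD.
have hg x : D x -> (h n x)%:E @[n --> \oo] --> (g x)%:E.
  by move=> Dx; apply: cvg_nnsfun_approx => // y _; rewrite lee_fin.
transitivity (limn (fun n => \int[nu]_(x in D) (h n x)%:E)%E).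
  rewrite -monotone_convergence//=.
  - by apply: eq_integral => x /[!inE] xD; apply/esym/cvg_lim => //; exact: hg.
  - by move=> n; apply/measurable_EFinP; exact: measurable_funTS.
  - by move=> n x _; rewrite lee_fin.
  - by move=> x _ a b ab; rewrite lee_fin; exact/lefP/nd_nnsfun_approx.
under eq_fun do rewrite integral_density_nnsfun//.
rewrite -monotone_convergence//=.
- apply: eq_integral => x /[!inE] xD; apply/cvg_lim => //.
  under eq_fun do rewrite EFinM.
  by rewrite EFinM; apply: cvgeZr => //; exact: hg.
- move=> n; apply/measurable_EFinP; apply: measurable_funM.
    by apply: measurable_funTS; exact: measurableT_comp.
  exact: measurable_funTS.
- by move=> n x _; rewrite lee_fin mulr_ge0.
- move=> x _ a b ab; rewrite lee_fin ler_wpM2r//.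
  exact/lefP/nd_nnsfun_approx.
Qed.

(** Indicators, simple functions and monotone limits give the formula for nonnegative [g]; since
    [f >= 0], taking positive and negative parts commutes with multiplication by [f]. *)
Lemma integral_density D (g : T2 -> R) : measurable D ->
  measurable_fun setT g ->
  (\int[nu]_(x in D) (g x)%:E
   = \int[m]_(x in phi @^-1` D) (g (phi x) * f x)%:E)%E.
Proof.
move=> mD mg; rewrite [LHS]integralE [RHS]integralE.
have posE (S : Type) (k : S -> R) : (EFin \o k)^\+%E = EFin \o (fun x => Num.max (k x) 0).
  by apply/funext => x; rewrite funeposE /= EFin_max.
have negE (S : Type) (k : S -> R) :
    (EFin \o k)^\-%E = EFin \o (fun x => Num.max (- k x) 0).
  by apply/funext => x; rewrite funenegE /= EFin_max.
have mmax (k : T2 -> R) : measurable_fun setT k ->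
    measurable_fun setT (fun x => Num.max (k x) 0).
  by move=> mk; exact: measurable_maxr.
rewrite !posE !negE !ge0_integral_density//; last 4 first.
- by apply: mmax; exact: measurableT_comp.
- by move=> x; rewrite le_max lexx orbT.
- exact: mmax.
- by move=> x; rewrite le_max lexx orbT.
congr (_ - _)%E; apply: eq_integral => x _ /=; congr EFin.
- by rewrite maxr_pMl// mul0r.
- by rewrite maxr_pMl// mul0r mulNr.
Qed.

End density.

(** * Lebesgue integrals on the line *)

Section lebesgue_real.
Variable R : realType.
Notation mu := (@lebesgue_measure R).
Implicit Types (f : R -> R) (A B : set R) (a b : R).

Lemma Rintegral_le_subset f A B : measurable A -> measurable B -> A `<=` B ->
  mu.-integrable B (EFin \o f) -> (forall x, B x -> 0 <= f x) ->
  \int[mu]_(x in A) f x <= \int[mu]_(x in B) f x.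
Proof.
move=> mA mB AB fB f0; apply: fine_le.
- by apply: integrable_fin_num => //; exact: integrableS fB.
- exact: integrable_fin_num.
- apply: ge0_subset_integral => //; first by have /integrableP[] := fB.
Qed.

Lemma integrable_cst_itv a b k : mu.-integrable `]a, b[ (EFin \o cst k).
Proof.
apply: measurable_bounded_integrable => //.
- by rewrite /= lebesgue_measure_itv/=; case: ifP; rewrite ?ltry// -EFinB ltry.
- by exists `|k|; split; [exact: num_real|move=> t kt x _ /=; exact: ltW].
Qed.

Lemma Rintegral_cst_itv a b k : a <= b ->
  \int[mu]_(x in `]a, b[) k = k * (b - a).
Proof.
move=> ab; rewrite Rintegral_cst//= lebesgue_measure_itv/= lte_fin.
have [//|ba] := ltP a b.
by have -> : b = a by [apply/eqP; rewrite eq_le ba ab]; rewrite subrr.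
Qed.

(** By symmetry the integral is twice that over the half-line, where the integrand is [r^-1] times
    the exponential density. *)
Lemma integrable_expR_abs r : 0 < r ->
  mu.-integrable setT (EFin \o (fun x => expR (- (r * `|x|)))).
Proof.
move=> r0; pose f (x : R) := expR (- (r * `|x|)).
have cf : continuous f.
  move=> x; apply: (@continuous_comp _ _ _ (fun y : R => - (r * `|y|)) expR).
    apply: continuousN; apply: cvgM; first exact: cvg_cst.
    exact: norm_continuous.
  exact: continuous_expR.
have mf : measurable_fun setT f by exact: continuous_measurable_fun.
apply/integrableP; split; first exact/measurable_EFinP.
under eq_integral do rewrite /= ger0_norm ?expR_ge0//.
rewrite (ge0_symfun_integralT _ cf); last 2 first.
- by move=> x; exact: expR_ge0.
- by move=> x; rewrite /f/= normrN.
rewrite -set_itvcy lte_mul_pinfty//.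
have hi : mu.-integrable setT (EFin \o (fun x => r^-1 * exponential_pdf r x)).
  under [X in _.-integrable _ X]eq_fun do rewrite /= EFinM.
  by apply: integrableZl => //; exact: integrable_exponential_pdf.
have hi0 : mu.-integrable `[0, +oo[
    (EFin \o (fun x => r^-1 * exponential_pdf r x)).
  exact: integrableS hi.
have /integrableP[_] := hi0; apply: le_lt_trans.
apply: ge0_le_integral => //=.
- by move=> x _; rewrite lee_fin expR_ge0.
- by apply/measurable_EFinP; exact: measurable_funTS.
- apply/measurable_EFinP; apply: measurableT_comp => //.
  apply: measurable_funTS; apply: measurable_funM => //.
  exact: measurable_exponential_pdf.
- move=> x; rewrite in_itv/= andbT => x0.
  rewrite exponential_pdfE// lee_fin mulKf ?gt_eqF//.
  by rewrite /f ger0_norm// ger0_norm ?expR_ge0// mulNr.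
Qed.

Lemma cvg_Rintegral_itv f : mu.-integrable setT (EFin \o f) ->
  \int[mu]_(x in `[- n%:R, n%:R]) f x @[n --> \oo] --> \int[mu]_x f x.
Proof.
move=> fi; apply: fine_cvg; rewrite fineK; last exact: integrable_fin_num.
under eq_fun do rewrite integral_mkcond.
have /integrableP[mf _] := fi.
apply: (@dominated_cvg _ _ _ mu _ measurableT
  (fun n => (EFin \o f) \_ `[- n%:R, n%:R]) _ (fun x => `|f x|%:E)) => //.
- by move=> n; apply/(measurable_restrictT _ _).1 => //; exact: measurable_funTS.
- move=> x _; apply: cvg_near_cst.
  near=> n; rewrite patchE mem_set//= in_itv/= -ler_norml.
  by near: n; exact: nbhs_infty_ger.
- exact: (integrable_abse fi).
- by move=> n x _; rewrite patchE; case: ifP => //=; rewrite normr0 lee_fin.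
Unshelve. all: end_near. Qed.

Lemma Rintegral_derive f df a b : a < b -> continuous df ->
  (forall x, is_derive x (1 : R) f (df x)) ->
  \int[mu]_(x in `[a, b]) df x = f b - f a.
Proof.
move=> ab cdf fdf; have cf := is_derive_continuous fdf.
rewrite /Rintegral (@continuous_FTC2 _ df f a b ab)//.
- exact: continuous_subspaceT.
- split => [x _||]; first by case: (fdf x).
  + by apply: cvg_at_right_filter; exact: cf.
  + by apply: cvg_at_left_filter; exact: cf.
- by move=> x _; rewrite derive1E; case: (fdf x).
Qed.

End lebesgue_real.

(** * The Gibbs measure and its concentration on the left half-line *)

Section gibbs_measure.
Variables (R : realType) (F : {mfun R >-> R}) (x0 x1 : R).
Hypotheses (F_dw : double_well F x0 x1) (F_wells : F x0 < F x1).
Notation mu := (@lebesgue_measure R).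

Lemma continuous_weight eps : continuous (weight F eps).
Proof.
move=> x; apply: (@continuous_comp _ _ _ (fun y : R => - F y / eps) expR).
  apply: cvgM; last exact: cvg_cst.
  by apply: cvgN; exact: (dw_continuous F_dw).
exact: continuous_expR.
Qed.

Lemma measurable_weight eps : measurable_fun setT (weight F eps).
Proof. exact: continuous_measurable_fun (@continuous_weight eps). Qed.

(** By [|x| - K <= F x], the weight is dominated by a multiple of [expR (- |x| / eps)]. *)
Lemma integrable_weight eps : 0 < eps ->
  mu.-integrable setT (EFin \o weight F eps).
Proof.
move=> eps0; have [K FK] := dw_coercive F_dw F_wells.
have hi : mu.-integrable setT
    (EFin \o (fun x => expR (K / eps) * expR (- (eps^-1 * `|x|)))).
  under [X in _.-integrable _ X]eq_fun do rewrite /= EFinM.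
  by apply: integrableZl => //; apply: integrable_expR_abs; rewrite invr_gt0.
apply: le_integrable hi => //.
  by apply/measurable_EFinP; exact: measurable_weight.
move=> x _ /=; rewrite lee_fin ger0_norm ?expR_ge0// ger0_norm; last first.
  by rewrite mulr_ge0 ?expR_ge0.
have -> : expR (K / eps) * expR (- (eps^-1 * `|x|)) = expR ((K - `|x|) / eps).
  by rewrite -expRD; congr expR; ring.
by rewrite ler_expR ler_wpM2r ?invr_ge0 ?(ltW eps0)//; have := FK x; lra.
Qed.

Lemma integrable_weightM eps A (f : R -> R) : 0 < eps -> measurable A ->
  measurable_fun setT f -> (exists M, forall x, `|f x| <= M) ->
  mu.-integrable A (EFin \o (fun x => f x * weight F eps x)).
Proof.
move=> eps0 mA mf [M fM].
apply: (@integrableS _ _ _ _ setT) => //.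
have hi : mu.-integrable setT (EFin \o (fun x => M * weight F eps x)).
  under [X in _.-integrable _ X]eq_fun do rewrite /= EFinM.
  by apply: integrableZl => //; exact: integrable_weight.
apply: le_integrable hi => //.
  apply/measurable_EFinP; apply: measurable_funM => //; exact: measurable_weight.
move=> x _ /=; rewrite lee_fin !normrM ler_wpM2r//.
by rewrite (le_trans (fM x))// ler_norm.
Qed.

Definition mass (eps : R) (A : set R) : R := \int[mu]_(x in A) weight F eps x.

Lemma integrable_weightS eps A : 0 < eps -> measurable A ->
  mu.-integrable A (EFin \o weight F eps).
Proof. by move=> eps0 mA; apply: integrableS (integrable_weight eps0). Qed.

Lemma mass_ge0 eps A : 0 <= mass eps A.
Proof. by apply: Rintegral_ge0 => x _; exact: expR_ge0. Qed.

Lemma le_mass eps A B : 0 < eps -> measurable A -> measurable B ->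
  A `<=` B -> mass eps A <= mass eps B.
Proof.
move=> eps0 mA mB AB; apply: Rintegral_le_subset => //.
- exact: integrable_weightS.
- by move=> x _; exact: expR_ge0.
Qed.

Lemma mass_itv_ge eps a b al : 0 < eps -> a <= b ->
  (forall x, a < x < b -> F x <= al) ->
  expR (- al / eps) * (b - a) <= mass eps `]a, b[.
Proof.
move=> eps0 ab Fal; rewrite -Rintegral_cst_itv//.
apply: le_Rintegral => //; first exact: integrable_cst_itv.
- exact: integrable_weightS.
- move=> x; rewrite /= in_itv/= => xab.
  by rewrite ler_expR ler_pM2r ?invr_gt0// lerN2 Fal.
Qed.

Lemma mass_left_gt0 eps : 0 < eps -> 0 < mass eps `]-oo, 0[.
Proof.
move=> eps0; have x00 := dw_left_lt0 F_dw.
apply: (@lt_le_trans _ _ (mass eps `](x0 - 1), x0[)).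
  apply: lt_le_trans (mass_itv_ge (al := F (x0 - 1)) eps0 _ _).
  - by rewrite mulr_gt0 ?expR_gt0//; lra.
  - lra.
  - by move=> x xx; apply: (dw_nincr_left F_dw); lra.
apply: le_mass => // x/=; rewrite !in_itv/=; lra.
Qed.

Lemma mass_gt0 eps : 0 < eps -> 0 < mass eps setT.
Proof.
by move=> eps0; apply: lt_le_trans (mass_left_gt0 eps0) _; exact: le_mass.
Qed.

Lemma mass_split eps : 0 < eps ->
  mass eps setT = mass eps `]-oo, 0[ + mass eps `[0, +oo[.
Proof.
move=> eps0; rewrite {1}/mass -(setUv `]-oo, 0[) setCitvl Rintegral_setU//.
  by apply: integrable_weightS => //; exact: measurableU.
by rewrite -setCitvl; apply/disj_setPS => x /= [].
Qed.

Lemma gibbsE eps A : 0 < eps -> measurable A ->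
  gibbs F eps A = (mass eps A)%:E.
Proof.
move=> eps0 mA; rewrite /gibbs /mass /Rintegral fineK//.
by apply: integrable_fin_num => //; exact: integrable_weightS.
Qed.

(** The total mass is finite and positive, so [mnormalize] does not take its default value. *)
Lemma varpiE eps A : 0 < eps -> measurable A ->
  varpi F eps A = (mass eps A / mass eps setT)%:E.
Proof.
move=> eps0 mA; have Z0 := mass_gt0 eps0.
by rewrite /varpi/= /mnormalize/= (gibbsE eps0 measurableT) gt_eqF ?lte_fin//= gibbsE.
Qed.

Lemma Rintegral_varpi eps A (f : R -> R) : 0 < eps -> measurable A ->
  measurable_fun setT f -> (exists M, forall x, `|f x| <= M) ->
  \int[varpi F eps]_(x in A) f x
  = (\int[mu]_(x in A) (f x * weight F eps x)) / mass eps setT.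
Proof.
move=> eps0 mA mf fM; have Z0 := mass_gt0 eps0.
rewrite -RintegralZr//; last exact: integrable_weightM.
congr fine.
rewrite [LHS](@integral_density _ _ _ _ _ mu (varpi F eps) id
  (fun x => weight F eps x / mass eps setT))//.
- by apply: eq_integral => x _; rewrite mulrA.
- by apply: measurable_funM => //; exact: measurable_weight.
- by move=> x; rewrite divr_ge0 ?expR_ge0// ltW.
- move=> B mB; rewrite preimage_id [LHS]varpiE//.
  rewrite -RintegralZr//; last exact: integrable_weightS.
  rewrite /Rintegral fineK//; apply: integrable_fin_num => //.
  under [X in _.-integrable _ X]eq_fun do rewrite /= EFinM.
  by apply: integrableZr => //; exact: integrable_weightS.
Qed.

(** From [1 + x <= expR x]; it turns exponential smallness into a bound linear in [eps]. *)
Lemma expRN_le_inv (k eps : R) : 0 < k -> 0 < eps ->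
  expR (- (k / eps)) <= eps / k.
Proof.
move=> k0 eps0; rewrite expRN -[leRHS]invf_div lef_pV2 ?posrE ?expR_gt0 ?divr_gt0//.
by have := expR_ge1Dx (k / eps); lra.
Qed.

(** The right half-line has mass at most a constant times [expR (- F x1 / eps)]. Near [x0], [F] is
    below the midpoint [k] of its two minimal values on an interval of mass at least
    [d * expR (- k / eps)]. The ratio is exponentially small, hence at most linear in [eps]. *)
Lemma mass_right_small : exists2 C, 0 <= C & forall eps, 0 < eps <= 1 ->
  mass eps `[0, +oo[ <= C * eps * mass eps `]-oo, 0[.
Proof.
have x00 := dw_left_lt0 F_dw.
pose k := (F x0 + F x1) / 2.
have [k0 k1] : F x0 < k /\ 0 < F x1 - k.
  by have Fw := F_wells; rewrite /k; split; lra.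
have [d d0 Fd] := continuous_near_lt (dw_continuous F_dw) k0.
pose D := expR (F x1) * mass 1 setT.
have D0 : 0 <= D by rewrite mulr_ge0 ?expR_ge0 ?mass_ge0.
exists (D / (d * (F x1 - k))).
  by rewrite divr_ge0// mulr_ge0// ltW.
move=> eps /andP[eps0 eps1].
have right_le : mass eps `[0, +oo[ <= expR (- F x1 / eps) * D.
  apply: (@le_trans _ _ (expR (- F x1 / eps) * (expR (F x1) * mass 1 `[0, +oo[))).
    rewrite mulrA -RintegralZl//; last exact: integrable_weightS.
    apply: le_Rintegral => //.
    - exact: integrable_weightS.
    - under [X in _.-integrable _ X]eq_fun do rewrite /= EFinM.
      by apply: integrableZl => //; exact: integrable_weightS.
    - move=> x; rewrite /= in_itv/= andbT => x_ge0.
      rewrite -!expRD ler_expR divr1.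
      have Fx := dw_min_right F_dw x_ge0.
      (* For [eps <= 1] the weight is compared with the one at [eps = 1], which makes [D]
         independent of [eps]. *)
      have : 0 <= (F x - F x1) * (eps^-1 - 1).
        by rewrite mulr_ge0 ?subr_ge0// -[leLHS]invr1 lef_pV2 ?posrE.
      lra.
  by rewrite !ler_wpM2l ?expR_ge0// le_mass.
have left_ge : expR (- k / eps) * d <= mass eps `]-oo, 0[.
  apply: (@le_trans _ _ (mass eps `](x0 - d), x0[)).
    rewrite -[X in _ * X](_ : x0 - (x0 - d) = _); last by ring.
    apply: mass_itv_ge => //; first lra.
    by move=> x xd; apply/ltW/Fd; rewrite ltr_norml; lra.
  by apply: le_mass => // x/=; rewrite !in_itv/=; lra.
apply: (le_trans right_le).
have -> : expR (- F x1 / eps) = expR (- ((F x1 - k) / eps)) * expR (- k / eps).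
  by rewrite -expRD; congr expR; ring.
have h := expRN_le_inv k1 eps0.
apply: (@le_trans _ _ (eps / (F x1 - k) * expR (- k / eps) * D)).
  by rewrite ler_wpM2r// ler_wpM2r ?expR_ge0.
have -> : eps / (F x1 - k) * expR (- k / eps) * D =
    D / (d * (F x1 - k)) * eps * (expR (- k / eps) * d).
  by field; rewrite !gt_eqF.
apply: ler_wpM2l left_ge; rewrite mulr_ge0 ?(ltW eps0)//.
by rewrite divr_ge0// mulr_ge0// ltW.
Qed.

End gibbs_measure.

Lemma integrable_varpi (R : realType) (F : {mfun R >-> R}) eps A
    (f : R -> R) : measurable A ->
  measurable_fun setT f -> (exists M, forall x, `|f x| <= M) ->
  (varpi F eps).-integrable A (EFin \o f).
Proof.
move=> mA mf [K fK]; apply: (@integrableS _ _ _ _ setT) => //.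
apply: measurable_bounded_integrable => //.
  by rewrite /= probability_setT ltry.
exists K; split; first exact: num_real.
by move=> k Kk x _ /=; rewrite (le_trans (fK x))// ltW.
Qed.

(** * Quantitative estimates for the second eigenpair *)

Section eigenpair_estimates.
Variables (R : realType) (F : {mfun R >-> R}) (x0 x1 : R).
Hypotheses (F_dw : double_well F x0 x1) (F_wells : F x0 < F x1).
Notation mu := (@lebesgue_measure R).

Section fixed_eps.
Variables (eps lam : R) (eta : R -> R).
Hypotheses (eps0 : 0 < eps) (ep : second_eigenpair F eps lam eta).

Lemma ep_derive x : is_derive x (1 : R) eta (derive1 eta x).
Proof.
have [[d1 _ _ _] _ _] := se_eigenfunction ep.
exact: derivable_is_derive.
Qed.

Lemma ep_derive2 x :
  is_derive x (1 : R) (derive1 eta) (derive1 (derive1 eta) x).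
Proof.
have [[_ d2 _ _] _ _] := se_eigenfunction ep.
exact: derivable_is_derive.
Qed.

Lemma ep_ode x : eps * derive1 (derive1 eta) x - derive1 F x * derive1 eta x
  = - lam * eta x.
Proof. by have [_ _] := se_eigenfunction ep; exact. Qed.

Lemma ep_rate_gt0 : 0 < lam.
Proof. by have [h _ _] := se_eigenvalue ep; rewrite -oppr_lt0. Qed.

Lemma ep_lbound : has_lbound (range eta).
Proof.
have [M etaM] := se_bounded ep; exists (- M) => _ [x _ <-].
by have := etaM x; rewrite ler_norml => /andP[].
Qed.

Lemma ep_continuous : continuous eta.
Proof. exact: is_derive_continuous ep_derive. Qed.

Lemma ep_measurable : measurable_fun setT eta.
Proof. exact: continuous_measurable_fun ep_continuous. Qed.

Lemma ep_lim_ninfty : lim_ninfty eta = inf (range eta).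
Proof.
apply: cvg_lim => //; apply: le_cvgNy_inf ep_lbound.
exact: eta_le (se_increasing ep).
Qed.

Lemma ep_lim_lt0 : lim_ninfty eta < 0.
Proof.
rewrite ep_lim_ninfty; have [r [etaN _ _]] := se_sign ep.
apply: le_lt_trans (etaN (r - 1) _); last by rewrite gtrBl.
by apply: ge_inf; [exact: ep_lbound|exists (r - 1)].
Qed.

Lemma ep_ge x : lim_ninfty eta <= eta x.
Proof.
by rewrite ep_lim_ninfty; apply: ge_inf; [exact: ep_lbound|exists x].
Qed.

Let flux_derive := is_derive_flux eps0 (dw_is_derive F_dw) ep_derive2 ep_ode.
Let flux_nneg := flux_ge0 F eps ep_derive (se_increasing ep).

Lemma ep_flux_small e : 0 < e ->
  exists B, forall x, x <= B -> flux F eps eta x <= e.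
Proof.
have [r [etaN _ _]] := se_sign ep.
have [K FK] := dw_coercive F_dw F_wells.
apply: (@flux_small _ F eps lam eta eps0 (dw_is_derive F_dw) ep_derive
  ep_derive2 ep_ode ep_rate_gt0 r (- `|K|) etaN _ ep_lbound).
(* [x <= - |K|] gives [K <= |x|], hence [F x >= 0]. *)
move=> x xK; have := FK x; have := ler_norm K.
rewrite (@ler0_norm _ x); last by have := normr_ge0 K; lra.
lra.
Qed.

Lemma ep_continuous_fluxslope :
  continuous (fun x => lam / eps * (- eta x * weight F eps x)).
Proof.
move=> x; apply: cvgM; first exact: cvg_cst.
apply: cvgM; last exact: (continuous_weight F_dw).
by apply: cvgN; exact: ep_continuous.
Qed.

Let mass := mass F.

(** The equation is integrated from far left, where the flux is negligible, with [- eta] bounded by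
    [- lim_ninfty eta]. *)
Lemma ep_flux_le_mass y : y < 0 ->
  flux F eps eta y <= lam / eps * - lim_ninfty eta * mass eps `]-oo, 0[.
Proof.
move=> y0; apply/ler_addgt0Pr => e /ep_flux_small[B Bu].
pose a := Num.min B (y - 1).
have [aB ay] : a <= B /\ a < y.
  by rewrite /a ge_min lexx; split=> //; rewrite gt_min gtrBl ltr01 orbT.
have h := Rintegral_derive ay ep_continuous_fluxslope flux_derive.
have iw := integrable_weightS F_dw F_wells eps0.
have c0 : 0 <= lam / eps * - lim_ninfty eta.
  rewrite mulr_ge0 ?divr_ge0 ?(ltW ep_rate_gt0) ?(ltW eps0)//.
  by rewrite oppr_ge0 ltW// ep_lim_lt0.
have : flux F eps eta y - flux F eps eta a
    <= lam / eps * - lim_ninfty eta * mass eps `[a, y].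
  rewrite -h -RintegralZl//; last exact: iw.
  apply: le_Rintegral => //.
  - under [X in _.-integrable _ X]eq_fun do rewrite /= EFinM.
    apply: integrableZl => //.
    apply: (integrable_weightM F_dw F_wells) => //.
      by apply: measurableT_comp => //; exact: ep_measurable.
    by have [M etaM] := se_bounded ep; exists M => x; rewrite normrN.
  - under [X in _.-integrable _ X]eq_fun do rewrite /= EFinM.
    by apply: integrableZl => //; exact: iw.
  - move=> x _; rewrite -[leRHS]mulrA ler_wpM2l//.
      by rewrite divr_ge0 ?(ltW ep_rate_gt0) ?(ltW eps0).
    by rewrite ler_wpM2r ?expR_ge0// lerN2 ep_ge.
have : lam / eps * - lim_ninfty eta * mass eps `[a, y]
    <= lam / eps * - lim_ninfty eta * mass eps `]-oo, 0[.
  rewrite ler_wpM2l//; apply: (le_mass F_dw F_wells) => // x/=.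
  by rewrite !in_itv/=; lra.
have := Bu _ aB; lra.
Qed.

(** Over [[- n, n]] the integral of [lam / eps * eta * weight] is the flux at [- n], which tends to
    0, minus the flux at [n], which is nonnegative. *)
Lemma ep_integral_le0 : \int[varpi F eps]_x eta x <= 0.
Proof.
have etaM := se_bounded ep.
have lr : 0 < lam / eps by rewrite divr_gt0// ep_rate_gt0.
rewrite (Rintegral_varpi F_dw F_wells)//; last exact: ep_measurable.
rewrite pmulr_lle0 ?invr_gt0 ?(mass_gt0 F_dw F_wells)//.
have ie : mu.-integrable setT (EFin \o (fun x => eta x * weight F eps x)).
  by apply: (integrable_weightM F_dw F_wells) => //; exact: ep_measurable.
have icvg := cvg_Rintegral_itv ie.
apply/ler_addgt0Pr => e e0; rewrite add0r.
have [B Bu] : exists B, forall x, x <= B -> flux F eps eta x <= lam / eps * e.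
  by apply: ep_flux_small; rewrite mulr_gt0.
apply: (cvgr_to_le icvg); near=> n.
have n0 : (0 : R) < n%:R by near: n; exact: nbhs_infty_gtr.
have nB : - n%:R <= B.
  by rewrite lerNl; near: n; exact: nbhs_infty_ger.
have nn : - n%:R < n%:R :> R by lra.
rewrite -(ler_pM2l lr); apply: le_trans (Bu _ nB).
have := Rintegral_derive nn ep_continuous_fluxslope flux_derive.
have -> : (fun x => lam / eps * (- eta x * weight F eps x)) =
   (fun x => - (lam / eps) * (eta x * weight F eps x)).
  by apply/funext => x; ring.
rewrite RintegralZl//; last exact: integrableS ie.
by have := flux_nneg n%:R; lra.
Unshelve. all: end_near. Qed.

(** Pointwise [|eta| <= eta + 2 * |lim_ninfty eta|], because [eta >= lim_ninfty eta]; the integral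
    of [eta] is nonpositive. *)
Lemma ep_integral_norm_le :
  \int[varpi F eps]_x `|eta x| <= 2 * `|lim_ninfty eta|.
Proof.
have [M etaM] := se_bounded ep; have H0 := ep_lim_lt0.
have ie : (varpi F eps).-integrable setT (EFin \o eta).
  by apply: integrable_varpi => //; [exact: ep_measurable|exists M].
have ic : (varpi F eps).-integrable setT (EFin \o cst (2 * `|lim_ninfty eta|)).
  apply: integrable_varpi => //; exists (2 * `|lim_ninfty eta|) => x.
  by rewrite ger0_norm// mulr_ge0.
apply: (@le_trans _ _ (\int[varpi F eps]_x (eta x + 2 * `|lim_ninfty eta|))).
  apply: le_Rintegral => //.
  - apply: integrable_varpi => //; last by exists M => x; rewrite normr_id.
    by apply: measurableT_comp => //; exact: ep_measurable.
  - by apply: integrableD ie ic.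
  - move=> x _; have := ep_ge x; rewrite (ltr0_norm H0).
    by have [|] := ger0P (eta x); lra.
rewrite RintegralD// Rintegral_cst//= [fine _](_ : _ = 1).
  by have := ep_integral_le0; lra.
by rewrite -[X in fine X]/(varpi F eps setT) probability_setT.
Qed.

End fixed_eps.

Lemma ep_rate_small : exists2 C, 0 <= C & forall eps lam eta, 0 < eps ->
  second_eigenpair F eps lam eta -> lam / eps <= C * eps.
Proof.
have [d [al [be [d0 [dx0 dx1] albe [F1 F2 F3 F4]]]]] := dw_levels F_dw F_wells.
exists (d ^+ 2 * (be - al))^-1.
  by rewrite invr_ge0 mulr_ge0 ?sqr_ge0//; lra.
move=> eps lam eta eps0 ep.
have [r [etaN etar etaP]] := se_sign ep.
suff h : lam / eps * d ^+ 2 <= expR (- ((be - al) / eps)).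
  have ba0 : 0 < be - al by rewrite subr_gt0.
  have -> : (d ^+ 2 * (be - al))^-1 * eps = eps / (be - al) / d ^+ 2.
    by field; rewrite !gt_eqF.
  rewrite ler_pdivlMr ?exprn_gt0//; apply: (le_trans h).
  exact: expRN_le_inv.
(* The open side of 0 without zero of [eta] is used: for [r <= 0] the barrier interval []0, d[] and
   the well [x1], for [r > 0] the interval []- d, 0[] and the well [x0]. *)
have [r_le0|r_gt0] := leP r 0.
- apply: (@rate_le_right _ F eps lam eta eps0 (dw_is_derive F_dw)
    (ep_derive ep) (ep_derive2 ep) (ep_ode ep) (ep_rate_gt0 ep)
    (se_increasing ep) r x1 d d) => //; first lra.
  by move=> x xd; apply: F4; lra.
- apply: (@rate_le_left _ F eps lam eta eps0 (dw_is_derive F_dw)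
    (ep_derive ep) (ep_derive2 ep) (ep_ode ep) (ep_rate_gt0 ep)
    (se_increasing ep) r x0 (- d) d) => //; [lra|lra|].
  by move=> x xd; apply: F3; lra.
Qed.

(** A pointwise lower bound for [- eta * weight] is integrated. Left of [x0], [eta] exceeds its
    limit by at most [c * C1]; between [x0] and 0, its further rise times the weight is at most
    [c * m * - x0], proportional to the mass [m] of the half-line. *)
Lemma ep_left_mass : exists2 C, 0 <= C & forall eps lam eta, 0 < eps <= 1 ->
  second_eigenpair F eps lam eta ->
  `|lim_ninfty eta| * ((1 - lam / eps * C) * fine (varpi F eps `]-oo, 0[%classic))
  <= - \int[varpi F eps]_(x in `]-oo, 0[) eta x.
Proof.
have x00 := dw_left_lt0 F_dw.
have [s [C [a0 [s0 C0 a00 gr]]]] := dw_growth_powR F_dw.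
pose a := Num.max a0 (1 - x0).
have [aa0 ax0] : a0 <= a /\ 1 - x0 <= a by rewrite /a !le_max !lexx orbT.
have apos : 0 < a by lra.
pose C1 := C / s * a `^ (- s) + (x0 + a) * (C * a `^ (- (s + 1)) + (x0 + a)).
have C10 : 0 <= C1.
  rewrite addr_ge0// ?mulr_ge0 ?powR_ge0 ?invr_ge0 ?(ltW C0) ?(ltW s0)//; first lra.
  by rewrite addr_ge0 ?mulr_ge0 ?powR_ge0 ?(ltW C0)//; lra.
(* [C1] comes from [eta x0 + H <= c * C1], and [x0 ^+ 2] from integrating the bound [- x0] over
   []x0, 0[], of length [- x0]. *)
exists (C1 + x0 ^+ 2); first by rewrite addr_ge0// sqr_ge0.
move=> eps lam eta /andP[eps0 eps1] ep.
have H0 := ep_lim_lt0 ep; set H := `|_|.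
have HE : H = - lim_ninfty eta by rewrite /H ltr0_norm.
have Hpos : 0 < H by rewrite HE oppr_gt0.
have Hinf : - inf (range eta) = H by rewrite HE (ep_lim_ninfty ep).
have lr : 0 <= lam / eps by rewrite divr_ge0 ?(ltW (ep_rate_gt0 ep))// ltW.
have [c cH] : exists c, c = lam / eps * H by eexists.
have c0 : 0 <= c by rewrite cH mulr_ge0// ltW.
have cE : c = lam / eps * - inf (range eta) by rewrite Hinf.
have m0 := mass_left_gt0 F_dw F_wells eps0; set m := mass _ _ _ in m0.
have Fgrowth z : z <= - a -> (- z) `^ (s + 1) <= C * - derive1 F z.
  move=> za; have := gr z; rewrite ltr0_norm ?ler0_norm//; first last.
  - lra.
  - by apply: (dw_derive1_left F_dw); lra.
  by apply; lra.
have etax0 : eta x0 + H <= c * C1.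
  rewrite -Hinf; apply: (@eta_left_le _ F eps lam eta eps0 (dw_is_derive F_dw)
    (ep_derive ep) (ep_derive2 ep) (ep_ode ep) (ep_rate_gt0 ep)
    (se_increasing ep) (ep_lbound ep) _ c cE x0 a s C) => //.
  - exact: ep_flux_small ep.
  - lra.
  - exact: (dw_nincr_left F_dw).
have etax x : x0 <= x -> x < 0 ->
    eta x <= eta x0 + c * m * (x - x0) * expR (F x / eps).
  move=> x0x x_lt0; apply: (@eta_right_le _ F eps eta eps0
    (ep_derive ep) (se_increasing ep) c x0 x m) => //.
  - by move=> y yx; rewrite cH HE; apply: (ep_flux_le_mass eps0 ep); lra.
  - by rewrite mulr_ge0// ltW.
  - by move=> y yx; apply: (dw_ndecr_left F_dw) => //; lra.
have pointwise x : x < 0 ->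
    (H - c * C1) * weight F eps x - c * m * - x0 * \1_(`]x0, 0[) x
    <= - eta x * weight F eps x.
  move=> x_lt0; rewrite indicE; have w0 := weight_gt0 F eps x.
  have [xx0|x0x] := leP x x0.
    rewrite memNset /= ?in_itv/=; last by rewrite ltNge xx0.
    rewrite mulr0 subr0 ler_pM2r//.
    by have := eta_le (se_increasing ep) xx0; lra.
  rewrite mem_set /= ?in_itv/= ?x0x// mulr1.
  have h := etax x (ltW x0x) x_lt0.
  (* The weight cancels the exponential in [etax], so the height of the barrier does not enter. *)
  have we : weight F eps x * expR (F x / eps) = 1.
    by rewrite /weight -expRD mulNr addNr expR0.
  have : eta x * weight F eps x <= (c * C1 - H) * weight F eps x + c * m * (x - x0).
    rewrite -[c * m * (x - x0)]mulr1 -we mulrA (mulrAC _ (weight F eps x)).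
    rewrite -mulrDl ler_pM2r//; lra.
  have : c * m * (x - x0) <= c * m * - x0.
    by apply: ler_wpM2l; [rewrite mulr_ge0// ltW|lra].
  rewrite mulrBl; lra.
have Z0 := mass_gt0 F_dw F_wells eps0.
rewrite (varpiE F_dw F_wells)//= (Rintegral_varpi F_dw F_wells)//; last 2 first.
- exact: ep_measurable ep.
- exact: se_bounded ep.
rewrite -[leRHS]mulNr [_ * (m / _)]mulrA [leLHS]mulrA ler_pM2r ?invr_gt0//.
have iw := integrable_weightS F_dw F_wells eps0 (measurable_itv `]-oo, (0 : R)[).
have i1 : mu.-integrable `]-oo, (0 : R)[
    (EFin \o (fun x => (H - c * C1) * weight F eps x)).
  under [X in _.-integrable _ X]eq_fun do rewrite /= EFinM.
  exact: integrableZl.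
have ind : \int[mu]_(x in `]-oo, 0[) \1_(`]x0, 0[) x = - x0.
  rewrite /Rintegral integral_indic//= setIidl.
    by rewrite lebesgue_measure_itv/= lte_fin x00 -EFinB sub0r.
  by move=> x/=; rewrite !in_itv/= => /andP[].
have ii : mu.-integrable `]-oo, (0 : R)[ (EFin \o \1_(`]x0, 0[)).
  by apply: integrableS (integrable_indic_itv _ _ _ _).
have i2 : mu.-integrable `]-oo, (0 : R)[
    (EFin \o (fun x => c * m * - x0 * \1_(`]x0, 0[) x)).
  under [X in _.-integrable _ X]eq_fun do rewrite /= EFinM.
  exact: integrableZl.
have i3 : mu.-integrable `]-oo, (0 : R)[
    (EFin \o (fun x => eta x * weight F eps x)).
  apply: (integrable_weightM F_dw F_wells) => //; last exact: se_bounded ep.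
  exact: ep_measurable ep.
have i4 : mu.-integrable `]-oo, (0 : R)[
    (EFin \o (fun x => - eta x * weight F eps x)).
  apply: (integrable_weightM F_dw F_wells) => //.
    by apply: measurableT_comp => //; exact: ep_measurable ep.
  by have [M etaM] := se_bounded ep; exists M => x; rewrite normrN.
have h : \int[mu]_(x in `]-oo, 0[)
      ((H - c * C1) * weight F eps x - c * m * - x0 * \1_(`]x0, 0[) x)
    <= \int[mu]_(x in `]-oo, 0[) (- eta x * weight F eps x).
  apply: le_Rintegral => //.
    by apply: eq_integrable (integrableB _ i1 i2).
rewrite RintegralB// !RintegralZl// ind -/(mass F eps _) -/m in h.
have -> : - (\int[mu]_(x in `]-oo, 0[) (eta x * weight F eps x)) =
    \int[mu]_(x in `]-oo, 0[) (- eta x * weight F eps x).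
  rewrite -mulN1r -RintegralZl//; apply: eq_Rintegral => x _; ring.
by apply: le_trans h; rewrite cH; lra.
Qed.

End eigenpair_estimates.

(** * From conditional probabilities to conditional expectations *)

Section conditional_law.
Context d (Omega : measurableType d) (R : realType) (P : probability Omega R).
Variables (F : {mfun R >-> R}) (eps : R) (eta : R -> R) (xi : 'I_2 -> R).
Variables (X : R -> Omega -> R) (Y : R -> Omega -> 'I_2) (t : R) (j : 'I_2).
Hypotheses (mX : measurable_fun setT (X t))
  (mY : measurable (Y t @^-1` [set j])).
Let al := alpha eta xi j.
Hypotheses (mal : measurable_fun setT al) (al0 : forall x, 0 <= al x)
  (al_bnd : exists M, forall x, `|al x| <= M)
  (law : forall G, measurable G ->
    cond_prob P F eps eta xi X Y t j G = \int[varpi F eps]_(x in G) al x).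

(** The law [nu] of [X t] on the event [Y t = j] has density [p * al] with respect to [varpi], and
    is also the image of [P] weighted by the indicator of the event. Integrating [g] both ways gives
    the formula; on a null event it is the convention. *)
Lemma cond_expectE (g : R -> R) : measurable_fun setT g ->
  (exists M, forall x, `|g x| <= M) ->
  cond_expect P F eps eta xi X Y t j g = \int[varpi F eps]_x (g x * al x).
Proof.
move=> mg [M gM]; rewrite /cond_expect; case: ifPn => // PE0.
set E := Y t @^-1` [set j]; pose p := fine (P E).
have PEE : P E = p%:E by rewrite fineK// fin_num_measure.
have p0 : 0 < p by rewrite -lte_fin -PEE lt0e PE0 measure_ge0.
pose image : {measure set R -> \bar R} := pushforward (mrestr P mY) (X t).
pose nu := image mX.
have nuE G : nu G = P (X t @^-1` G `&` E) by [].
have mXG G : measurable G -> measurable (X t @^-1` G).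
  by move=> mG; rewrite -[X in measurable X]setTI; exact: mX.
have nu_varpi G : measurable G ->
    nu G = (\int[varpi F eps]_(x in id @^-1` G) (p * al x)%:E)%E.
  move=> mG; have := law mG; rewrite /cond_prob /cond_expect (negbTE PE0).
  have -> : \int[P]_(w in E) \1_G (X t w) = fine (nu G).
    rewrite nuE /Rintegral -[in RHS]integral_indic//; last exact: mXG.
  move/(canRL (divfK _)); rewrite -/E -/p gt_eqF// => /(_ isT) h.
  rewrite -[LHS]fineK; last by rewrite nuE fin_num_measure//; apply: measurableI => //; exact: mXG.
  rewrite h mulrC -RintegralZl//; last exact: integrable_varpi.
  rewrite /Rintegral fineK//; apply: integrable_fin_num => //.
  under [X in _.-integrable _ X]eq_fun do rewrite /= EFinM.
  by apply: integrableZl => //; exact: integrable_varpi.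
have nu_P G : measurable G ->
    nu G = (\int[P]_(w in X t @^-1` G) (\1_E w)%:E)%E.
  move=> mG; rewrite [RHS]integral_indic; [|exact: mXG|exact: mY].
  by rewrite nuE setIC.
have mE : measurable_fun setT (\1_E : Omega -> R) by exact: measurable_indic.
have h1 := integral_density mX mE (fun x => ler0n _ _) nu_P measurableT mg.
have h2 : (\int[nu]_x (g x)%:E =
    \int[varpi F eps]_x (g x * (p * al x))%:E)%E.
  apply: (integral_density _ _ _ nu_varpi) => //.
  - exact: measurable_funM.
  - by move=> x; rewrite mulr_ge0// ltW.
have -> : \int[P]_(w in E) g (X t w) = p * \int[varpi F eps]_x (g x * al x).
  rewrite -RintegralZl//; last first.
    apply: integrable_varpi => //; first exact: measurable_funM.
    have [K alK] := al_bnd; exists (M * K) => x; rewrite normrM ler_pM//.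
  rewrite /Rintegral; congr fine.
  under [RHS]eq_integral do rewrite mulrCA.
  rewrite -h2 h1 preimage_setT integral_mkcond.
  apply: eq_integral => w _; rewrite patchE indicE.
  by case: (w \in E); rewrite ?mulr1 ?mulr0.
by rewrite mulrAC divff ?mul1r ?gt_eqF.
Qed.

End conditional_law.

(** * Expectations under the invariant law and under its tilts by [alpha] *)

Section stationary_expectations.
Variables (R : realType) (F : {mfun R >-> R}) (x0 x1 : R).
Hypotheses (F_dw : double_well F x0 x1) (F_wells : F x0 < F x1).

Lemma varpi_left_bounds : exists2 C, 0 <= C & forall eps, 0 < eps <= 1 ->
  [/\ 0 < fine (varpi F eps `]-oo, 0[%classic),
      fine (varpi F eps `]-oo, 0[%classic) <= 1
    & 1 - fine (varpi F eps `]-oo, 0[%classic) <= C * eps].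
Proof.
have [C C0 hC] := mass_right_small F_dw F_wells; exists C => // eps eps01.
have /andP[eps0 _] := eps01; have := hC _ eps01.
have Z0 := mass_gt0 F_dw F_wells eps0.
have m0 := mass_left_gt0 F_dw F_wells eps0.
rewrite (varpiE F_dw F_wells)//=.
have mZ : mass F eps `]-oo, 0[ <= mass F eps setT by exact: (le_mass F_dw F_wells).
move=> h; split; first exact: divr_gt0.
  by rewrite ler_pdivrMr// mul1r.
rewrite -[X in X - _](divff (lt0r_neq0 Z0)) -mulrBl ler_pdivrMr//.
rewrite {1}(mass_split F_dw F_wells)// addrAC subrr add0r (le_trans h)//.
by rewrite ler_wpM2l// mulr_ge0// ltW.
Qed.

Lemma Rintegral_varpi_norm_le eps A (f : R -> R) M : measurable A ->
  measurable_fun setT f -> (forall x, `|f x| <= M) ->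
  `|\int[varpi F eps]_(x in A) f x| <= M * fine (varpi F eps A).
Proof.
move=> mA mf fM; rewrite -Rintegral_cst//.
apply: le_trans (le_normr_Rintegral _ _) _ => //.
  by apply: integrable_varpi => //; exists M.
apply: le_Rintegral => //.
- apply: integrable_varpi => //; first exact: measurableT_comp.
  by exists M => x; rewrite normr_id.
- by apply: integrable_varpi => //; exists `|M| => x.
Qed.

Lemma left_expect_close eps (g : R -> R) M : measurable_fun setT g ->
  (forall x, `|g x| <= M) -> 0 < fine (varpi F eps `]-oo, 0[%classic) ->
  `|\int[varpi F eps]_x g x - left_expect F eps g|
  <= 2 * M * (1 - fine (varpi F eps `]-oo, 0[%classic)).
Proof.
move=> mg gM; set q := fine _ => q0.
have gi A : measurable A -> (varpi F eps).-integrable A (EFin \o g).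
  by move=> mA; apply: integrable_varpi => //; exists M.
have q' : fine (varpi F eps `[0, +oo[%classic) = 1 - q.
  by rewrite -setCitvl probability_setC// fineB// fin_num_measure.
have q1 : 0 <= 1 - q by rewrite -q' fine_ge0.
rewrite -[X in \int[_]_(x in X) _](setUv `]-oo, (0 : R)[) setCitvl.
rewrite Rintegral_setU//; last 2 first.
- by apply: gi; exact: measurableU.
- by rewrite -setCitvl; apply/disj_setPS => x /= [].
rewrite /left_expect -/q.
have h1 := Rintegral_varpi_norm_le eps (measurable_itv `]-oo, (0 : R)[) mg gM.
have h2 := Rintegral_varpi_norm_le eps (measurable_itv `[(0 : R), +oo[) mg gM.
rewrite -/q in h1; rewrite q' in h2.
move: h1 h2; set I := \int[_]_(x in _) _; set J := \int[_]_(x in _) _ => h1 h2.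
(* [J] is at most [M * (1 - q)] in absolute value, and the average [I / q] at most [M]. *)
have -> : I + J - I / q = J - I / q * (1 - q) by field; rewrite gt_eqF.
rewrite (le_trans (ler_normB _ _))// normrM (ger0_norm q1).
have : `|I / q| <= M by rewrite normrM normfV (gtr0_norm q0) ler_pdivrMr.
move=> /(ler_wpM2r q1); lra.
Qed.

Lemma left_expect_indic eps : 0 < fine (varpi F eps `]-oo, 0[%classic) ->
  left_expect F eps (\1_(`]-oo, 0[%classic) : R -> R) = 1.
Proof.
move=> q0; rewrite /left_expect /Rintegral integral_indic// setIid.
by rewrite divff// gt_eqF.
Qed.

Section eigenpair.
Variables (eps lam : R) (eta : R -> R) (xi : 'I_2 -> R).
Hypotheses (eps0 : 0 < eps) (ep : second_eigenpair F eps lam eta)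
  (adm : admissible eta xi).

Lemma ep_le_pinfty x : eta x <= lim_pinfty eta.
Proof.
have ub : has_ubound (range eta).
  have [M etaM] := se_bounded ep; exists M => _ [y _ <-].
  exact: le_trans (ler_norm _) (etaM y).
have nd := eta_le (se_increasing ep).
rewrite /lim_pinfty (cvg_lim _ (nondecreasing_cvgr nd ub))//.
by apply: ub_le_sup => //; exists x.
Qed.

(** The infimum of [xi j * eta] is approached at minus infinity if [xi j >= 0] and at plus infinity
    otherwise; admissibility keeps it at least -1. *)
Lemma alpha_ge0 j x : 0 <= alpha eta xi j x.
Proof.
have [/(_ j) /andP[xi1 xi2] _] := adm; rewrite /alpha.
have HN := ep_lim_lt0 ep; have HP : 0 < lim_pinfty eta.
  have [r [_ _ etaP]] := se_sign ep.
  by apply: lt_le_trans (etaP (r + 1) _) (ep_le_pinfty _); rewrite ltrDl.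
have [xi0|xi0] := leP 0 (xi j).
  have : xi j * lim_ninfty eta <= xi j * eta x by rewrite ler_wpM2l// (ep_ge ep).
  have : -1 <= xi j * lim_ninfty eta.
    rewrite -[lim_ninfty eta]opprK mulrN lerN2 -ltr0_norm//.
    by rewrite -ler_pdivlMr ?normr_gt0 ?lt_eqF// div1r.
  lra.
have : xi j * lim_pinfty eta <= xi j * eta x.
  by rewrite ler_wnM2l ?(ltW xi0)// ep_le_pinfty.
have : -1 <= xi j * lim_pinfty eta.
  by rewrite -ler_pdivrMr// mulN1r.
lra.
Qed.

Lemma alpha_measurable j : measurable_fun setT (alpha eta xi j).
Proof.
apply: measurable_funD => //; apply: measurable_funM => //.
exact: ep_measurable ep.
Qed.

Lemma alpha_bounded j : exists M, forall x, `|alpha eta xi j x| <= M.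
Proof.
have [M etaM] := se_bounded ep; exists (1 + `|xi j| * M) => x.
rewrite /alpha (le_trans (ler_normD _ _))// normr1 lerD2l normrM.
by rewrite ler_wpM2l.
Qed.

Lemma Rintegral_alpha j A (g : R -> R) : measurable A ->
  measurable_fun setT g -> (exists M, forall x, `|g x| <= M) ->
  \int[varpi F eps]_(x in A) (g x * alpha eta xi j x)
  = \int[varpi F eps]_(x in A) g x
    + xi j * \int[varpi F eps]_(x in A) (g x * eta x).
Proof.
move=> mA mg [M gM]; have [K etaK] := se_bounded ep.
have i1 : (varpi F eps).-integrable A (EFin \o (fun x => g x * eta x)).
  apply: integrable_varpi => //.
    by apply: measurable_funM => //; exact: ep_measurable ep.
  by exists (M * K) => x; rewrite normrM ler_pM.
rewrite -RintegralZl// -RintegralD//.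
- by apply: eq_Rintegral => x _; rewrite /alpha; ring.
- by apply: integrable_varpi => //; exists M.
- under [X in _.-integrable _ X]eq_fun do rewrite /= EFinM.
  exact: integrableZl.
Qed.

(** The difference is [xi j] times the integral of [g * eta], and [|eta|] has integral at most
    [2 * |lim_ninfty eta|]. *)
Lemma Rintegral_alpha_close j (g : R -> R) M : measurable_fun setT g ->
  (forall x, `|g x| <= M) ->
  `|\int[varpi F eps]_x (g x * alpha eta xi j x) - \int[varpi F eps]_x g x|
  <= 2 * M * (`|xi j| * `|lim_ninfty eta|).
Proof.
move=> mg gM; rewrite Rintegral_alpha//; last by exists M.
rewrite addrAC subrr add0r normrM.
have M0 : 0 <= M by exact: le_trans (gM 0).
have [K etaK] := se_bounded ep; have meta := ep_measurable ep.
have h : `|\int[varpi F eps]_x (g x * eta x)|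
    <= M * \int[varpi F eps]_x `|eta x|.
  have i1 : (varpi F eps).-integrable setT (EFin \o (fun x => `|eta x|)).
    apply: integrable_varpi => //; first exact: measurableT_comp.
    by exists K => x; rewrite normr_id.
  have mge : measurable_fun setT (fun x => g x * eta x).
    exact: measurable_funM.
  have gK : exists L, forall x, `|g x * eta x| <= L.
    by exists (M * K) => x; rewrite normrM ler_pM.
  rewrite -RintegralZl//.
  apply: le_trans (le_normr_Rintegral _ _) _ => //.
    exact: integrable_varpi.
  apply: le_Rintegral => //.
  - apply: integrable_varpi => //; first exact: measurableT_comp.
    by have [L gL] := gK; exists L => x; rewrite normr_id.
  - under [X in _.-integrable _ X]eq_fun do rewrite /= EFinM.
    exact: integrableZl.
  - by move=> x _; rewrite normrM ler_wpM2r.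
have h2 := ep_integral_norm_le F_dw F_wells eps0 ep.
have -> : 2 * M * (`|xi j| * `|lim_ninfty eta|)
    = `|xi j| * (M * (2 * `|lim_ninfty eta|)) by ring.
by rewrite ler_wpM2l// (le_trans h)// ler_wpM2l.
Qed.

End eigenpair.
End stationary_expectations.

(** Arithmetic of the implication from (1) to (a): [q] stands for the mass of the negative
    half-line, [I] for the integral of [eta] there, [rho] for [lam / eps], [x] for [xi eps 0], [H]
    for [|lim_ninfty eta|]. For small [eps], [q] and [1 - rho * C2] are at least 1/2, so
    [H <= 4 * |I|], while [x * I] is a difference of two terms of size at most [e / 8]. *)
Lemma slope_bound (R : realFieldType) (e eps q rho Cq C1 C2 x I H : R) :
  0 <= C2 -> 0 <= H -> q <= 1 -> 1 - q <= Cq * eps -> rho <= C1 * eps ->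
  8 * (Cq * eps) <= e -> 2 * (Cq * eps) <= 1 -> 2 * (C1 * eps * C2) <= 1 ->
  H * ((1 - rho * C2) * q) <= - I -> `|1 - (q + x * I)| <= e / 8 ->
  `|x| * H <= e.
Proof.
move=> C20 H0 q1 qC rhoC Ce C_half C1_half HI xI.
have rho2 : rho * C2 <= C1 * eps * C2 by rewrite ler_wpM2r.
have H4I : H <= 4 * `|I|.
  have : 1 * 1 <= (2 * (1 - rho * C2)) * (2 * q) by rewrite ler_pM//; lra.
  move=> /(ler_wpM2l H0); have := ler_norm (- I); rewrite normrN.
  move: HI; set a := H * (_ * _) => HI NI.
  have -> : H * (2 * (1 - rho * C2) * (2 * q)) = 4 * a by rewrite /a; ring.
  by rewrite mulr1 mulr1; lra.
have : `|x * I| <= e / 4.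
  have -> : x * I = (1 - q) - (1 - (q + x * I)) by ring.
  by rewrite (le_trans (ler_normB _ _))// (ger0_norm (_ : 0 <= 1 - q)); lra.
have : `|x| * H <= `|x| * (4 * `|I|) by rewrite ler_wpM2l.
rewrite normrM mulrCA; lra.
Qed.

(** * Equivalence of concentration, smallness of [xi eps 0] and convergence of expectations *)

Theorem theorem4p2 (R : realType) (F : {mfun R >-> R}) (x0 x1 : R)
  (F_dw : double_well F x0 x1)
  (F_wells : F x0 < F x1)
  (lam : R -> R) (eta : R -> R -> R)
  (eigen : forall eps, 0 < eps -> second_eigenpair F eps (lam eps) (eta eps))
  (xi : R -> 'I_2 -> R)
  (xi_adm : forall eps, 0 < eps -> admissible (eta eps) (xi eps))
  (p : R -> 'I_2 -> R)
  (p_prob : forall eps, 0 < eps -> is_probability_vector (p eps))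
  (d : R -> measure_display) (Omega : forall eps, measurableType (d eps))
  (P : forall eps, probability (Omega eps) R)
  (X : forall eps, R -> Omega eps -> R)
  (Y : forall eps, R -> Omega eps -> 'I_2)
  (XY : forall eps, 0 < eps ->
    coupled_process (P eps) F eps (lam eps) (eta eps) (xi eps) (p eps)
      (X eps) (Y eps))
  (XY_cond_law : forall eps t j (G : set R), 0 < eps -> 0 <= t ->
    measurable G ->
    cond_prob (P eps) F eps (eta eps) (xi eps) (X eps) (Y eps) t j G
    = \int[varpi F eps]_(x in G) alpha (eta eps) (xi eps) j x) :
  let cond1 := forall t : R, 0 <= t ->
    cond_prob (P eps) F eps (eta eps) (xi eps) (X eps) (Y eps) t 0 `]-oo, 0[%classic
      @[eps --> 0^'+] --> (1 : R) in
  let conda :=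
    (fun eps => xi eps 0) =o_ (0^'+) (fun eps => `|lim_ninfty (eta eps)|^-1) in
  let condb := forall (t : R) (g : R -> R), 0 <= t ->
    (exists M, forall x, `|g x| <= M) -> measurable_fun setT g ->
    {for x0, continuous g} -> {for x1, continuous g} ->
    cond_expect (P eps) F eps (eta eps) (xi eps) (X eps) (Y eps) t 0 g
      - left_expect F eps g @[eps --> 0^'+] --> (0 : R) in
  (cond1 <-> conda) /\ (conda <-> condb).
Proof.
move=> cond1 conda condb.
have near01 (k : R) : 0 < k -> \forall e \near 0^'+, 0 < e < k.
  move=> k0; near=> e; apply/andP; split.
    by near: e; exact: nbhs_right_gt.
  by near: e; exact: nbhs_right_lt.
have ceE eps t (g : R -> R) : 0 < eps -> 0 <= t -> measurable_fun setT g ->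
    (exists M, forall x, `|g x| <= M) ->
    cond_expect (P eps) F eps (eta eps) (xi eps) (X eps) (Y eps) t 0 g
    = \int[varpi F eps]_x (g x * alpha (eta eps) (xi eps) 0 x).
  move=> eps0 t0 mg gM; have ep := eigen _ eps0; have cp := XY _ eps0.
  apply: (cond_expectE _ _ (alpha_measurable (xi eps) ep 0)
    (alpha_ge0 ep (xi_adm _ eps0) 0) (alpha_bounded (xi eps) ep 0)) => //.
  - by have := cp_measX cp t0.
  - by have := cp_measY cp 0 t0.
  - by move=> G mG; exact: XY_cond_law.
have [Cq Cq0 qP] := varpi_left_bounds F_dw F_wells.
have condab : conda -> condb.
  move=> /eqoP ha t g t0 [M gM] mg _ _; have M0 : 0 <= M by exact: le_trans (gM 0).
  apply/cvgrPdist_le => e e0.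
  (* The total error will be [2 * M * (Cq + 1) * (e / K)]; the added ones keep [K] positive. *)
  pose K := 4 * (M + 1) * (Cq + 1).
  have K0 : 0 < K by rewrite !mulr_gt0//; lra.
  have ha' := ha (e / K) (divr_gt0 e0 K0).
  near=> eps.
  have /andP[eps0 epsK] : 0 < eps < Num.min 1 (e / K).
    by near: eps; apply: near01; rewrite lt_min ltr01 divr_gt0.
  move: epsK; rewrite lt_min => /andP[eps1 epsK].
  have [q0 q1 qC] := qP eps ltac:(by rewrite eps0 ltW).
  have H0 : 0 < `|lim_ninfty (eta eps)|.
    by rewrite normr_gt0 lt_eqF// (ep_lim_lt0 (eigen _ eps0)).
  have xiH : `|xi eps 0| * `|lim_ninfty (eta eps)| <= e / K.
    have : `|xi eps 0| <= e / K * `|(`|lim_ninfty (eta eps)|^-1)|.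
      by near: eps; exact: ha'.
    by rewrite normfV normr_id ler_pdivlMr.
  rewrite sub0r normrN ceE//; last by exists M.
  have h1 := left_expect_close mg gM q0.
  have h2 := Rintegral_alpha_close F_dw F_wells (xi eps) eps0 (eigen _ eps0) 0 mg gM.
  move: h1 h2; set a := \int[_]_x _; set b := \int[_]_x _; set c := left_expect _ _ _.
  move=> h1 h2.
  (* The stationary mean [a] is inserted: the tilt by [alpha] is controlled by (a), the restriction
     to the negative half-line by the small mass of its complement. *)
  have -> : b - c = (b - a) + (a - c) by ring.
  apply: (le_trans (ler_normD _ _)); apply: (le_trans (lerD h2 h1)).
  have h3 : 2 * M * (`|xi eps 0| * `|lim_ninfty (eta eps)|) <= 2 * M * (e / K).
    by rewrite ler_wpM2l// mulr_ge0.
  have h4 : 2 * M * (1 - fine (varpi F eps `]-oo, 0[%classic))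
      <= 2 * M * (Cq * (e / K)).
    rewrite ler_wpM2l ?mulr_ge0// (le_trans qC)// ler_wpM2l//; exact: ltW.
  apply: (le_trans (lerD h3 h4)).
  have -> : 2 * M * (e / K) + 2 * M * (Cq * (e / K))
      = e * ((2 * M * (Cq + 1)) / K) by ring.
  rewrite ler_piMr ?(ltW e0)// ler_pdivrMr// mul1r /K ler_wpM2r//; lra.
(* The indicator of the negative half-line jumps only at 0, away from [x0] and [x1], and its
   [left_expect] is 1. *)
have condb1 : condb -> cond1.
  move=> hb t t0.
  have mI : measurable_fun setT (\1_(`]-oo, 0[%classic) : R -> R).
    exact: measurable_indic.
  have I1 : forall x : R, `|\1_(`]-oo, 0[%classic) x : R| <= 1.
    by move=> x; rewrite /= indicE normr_nat lern1 leq_b1.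
  have c0 : {for x0, continuous (\1_(`]-oo, 0[%classic) : R -> R)}.
    have x00 := dw_left_lt0 F_dw.
    apply: cvg_near_cst; near=> x.
    have x_lt0 : x < 0 by near: x; exact: lt_nbhsl.
    by rewrite /= !indicE !mem_set//= in_itv.
  have c1 : {for x1, continuous (\1_(`]-oo, 0[%classic) : R -> R)}.
    have x10 := dw_right_gt0 F_dw.
    apply: cvg_near_cst; near=> x.
    have x_gt0 : 0 < x by near: x; exact: lt_nbhsr.
    by rewrite /= !indicE !memNset//= in_itv/= ltNge ltW.
  have /cvgrPdist_le hbt := hb t _ t0 (ex_intro _ 1 I1) mI c0 c1.
  apply/cvgrPdist_le => e e0; have hbe := hbt e e0; near=> eps.
  have /andP[eps0 eps1] : 0 < eps < 1 by near: eps; exact: near01.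
  have [q0 _ _] := qP eps ltac:(by rewrite eps0 ltW).
  rewrite -normrN opprB -(left_expect_indic q0) -normrN -(sub0r (_ - _)).
  by near: eps.
have cond1a : cond1 -> conda.
  move=> h1; apply/eqoP => e e0.
  have [C1 C10 rateP] := ep_rate_small F_dw F_wells.
  have [C2 C20 leftP] := ep_left_mass F_dw F_wells.
  (* Condition (1) is taken at time 0; the conditional law is the same at all times. *)
  have /cvgrPdist_le h10 := h1 0 (lexx _).
  have h1e := h10 (e / 8) ltac:(lra).
  have Cq1 : 0 < Cq + 1 by rewrite ltr_wpDl.
  have C11 : 0 < C1 + 1 by rewrite ltr_wpDl.
  have C21 : 0 < C2 + 1 by rewrite ltr_wpDl.
  near=> eps.
  (* Besides [eps < 1], the thresholds are those required by [slope_bound]; the added ones keep the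
     denominators positive. *)
  pose k := Num.min (Num.min 1 (e / (8 * (Cq + 1))))
    (Num.min (2 * (Cq + 1))^-1 (2 * (C1 + 1) * (C2 + 1))^-1).
  have /andP[eps0 epsk] : 0 < eps < k.
    near: eps; apply: near01.
    by rewrite !lt_min ltr01 !invr_gt0 divr_gt0 ?mulr_gt0.
  move: epsk; rewrite !lt_min => /andP[/andP[eps1 epsq] /andP[epsq' epsr]].
  have [q0 q1 qC] := qP eps ltac:(by rewrite eps0 ltW).
  have ep := eigen _ eps0.
  have H0 : 0 < `|lim_ninfty (eta eps)|.
    by rewrite normr_gt0 lt_eqF// (ep_lim_lt0 ep).
  have rate_eps := rateP _ _ _ eps0 ep.
  have left_eps := leftP eps _ _ ltac:(by rewrite eps0 ltW) ep.
  have lawE : cond_prob (P eps) F eps (eta eps) (xi eps) (X eps) (Y eps) 0 0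
        `]-oo, 0[%classic
      = fine (varpi F eps `]-oo, 0[%classic)
        + xi eps 0 * \int[varpi F eps]_(x in `]-oo, 0[) eta eps x.
    rewrite XY_cond_law//.
    have one_bounded : exists M, forall x : R, `|(cst 1 : R -> R) x| <= M.
      by exists 1 => x; rewrite normr1.
    have := Rintegral_alpha (xi eps) ep 0 (measurable_itv `]-oo, (0 : R)[)
      (measurable_cst (1 : R)) one_bounded.
    rewrite Rintegral_cst// mul1r => h.
    transitivity (\int[varpi F eps]_(x in `]-oo, 0[)
        (cst 1 x * alpha (eta eps) (xi eps) 0 x)).
      by apply: eq_Rintegral => x _; rewrite mul1r.
    rewrite h; congr (_ + _ * _).
    by apply: eq_Rintegral => x _; rewrite mul1r.
  have : `|1 - cond_prob (P eps) F eps (eta eps) (xi eps) (X eps) (Y eps) 0 0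
        `]-oo, 0[%classic| <= e / 8 by near: eps; exact: h1e.
  rewrite lawE => law_eps; rewrite normfV normr_id ler_pdivlMr//.
  apply: (slope_bound C20 (ltW H0) q1 qC rate_eps _ _ _ left_eps law_eps).
  - rewrite ltr_pdivlMr in epsq; last exact: mulr_gt0.
    have : Cq * eps <= (Cq + 1) * eps by rewrite ler_pM2r// lerDl.
    by move: epsq; clear; lra.
  - rewrite -div1r ltr_pdivlMr in epsq'; last exact: mulr_gt0.
    have : Cq * eps <= (Cq + 1) * eps by rewrite ler_pM2r// lerDl.
    by move: epsq'; clear; lra.
  - rewrite -div1r ltr_pdivlMr in epsr; last by rewrite !mulr_gt0.
    have := mulr_ge0 C20 (ltW eps0); have := mulr_ge0 C10 (ltW eps0).
    by move: epsr eps0; clear; lra.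
(* The cycle is closed: (a) gives (b), (b) gives (1), and (1) gives (a). *)
by split; split; [move/cond1a|move/condab/condb1| |move/condb1/cond1a].
Unshelve. all: end_near. Qed.
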